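(* If $A$ is a gendo-symmetric algebra, i.e. the endomorphism algebra of a generator over some symmetric algebra, then $\operatorname{rigdim}(A)\leq\operatorname{domdim}(A)$.
   Context: $k$ is a field; algebras are finite-dimensional associative unital $k$-algebras, modules are finite-dimensional left modules. A generator over an algebra $\Lambda$ is a $\Lambda$-module $M$ with $\Lambda\in\operatorname{add}(M)$, where $\operatorname{add}(M)$ consists of direct summands of finite direct sums of copies of $M$. $\mathrm{D}=\operatorname{Hom}_k(-,k)$. An $A$-module $M$ is a generator-cogenerator if $A$ and $\mathrm{D}(A_A)$ lie in $\operatorname{add}(M)$. $\operatorname{domdim} E$ is the largest $t\in\mathbb{N}_0$, or $\infty$, such that in a minimal injective resolution $0\to {}_EE\to I^0\to I^1\to\cdots$ all $I^i$ with $0\leq i<t$ are projective. $\operatorname{rigdim}(A)=\sup\{\operatorname{domdim}\operatorname{End}_A(M)\mid M$ a generator-cogenerator in $A\text{-mod}$ with $\operatorname{gldim}\operatorname{End}_A(M)<\infty\}$. *)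

(* Defs.v *)
From HB Require Import structures.
From mathcomp Require Import all_boot all_algebra all_field.
From mathcomp Require Import boolp classical_sets.

Set Implicit Arguments.
Unset Strict Implicit.
Unset Printing Implicit Defensive.

Import GRing.Theory.

Local Open Scope ring_scope.

(* Extended natural numbers: [None] stands for infinity. *)
Definition enat := option nat.
Notation einfty := (None : enat).

Definition enat_le (x y : enat) : Prop :=
  match x, y with
  | _, None => True
  | None, Some _ => False
  | Some m, Some n => (m <= n)%N
  end.

Definition is_esup (S : set enat) (s : enat) : Prop :=
  (forall x, S x -> enat_le x s) /\
  (forall u, (forall x, S x -> enat_le x u) -> enat_le s u).

Definition esup (S : set enat) : enat := xget einfty [set s | is_esup S s].

Definition einf (S : set enat) : enat :=
  esup [set l | forall x, S x -> enat_le l x].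

Lemma esupP (S : set enat) : is_esup S (esup S).
Proof.
rewrite /esup; case: xgetP => [s _ //|noS]; exfalso.
pose P n := `[< forall x, S x -> enat_le x (Some n) >].
case: (pselect (exists n, P n)) => [exP|nP].
  case: (ex_minnP exP) => m /asboolP Pm minm.
  apply: (noS (Some m)); split=> // -[n|//] un.
  by apply: minm; apply/asboolP.
apply: (noS None); split=> [[]//|[n un|//]].
by apply: nP; exists n; apply/asboolP.
Qed.

Lemma enat_le_anti (x y : enat) : enat_le x y -> enat_le y x -> x = y.
Proof.
by case: x y => [m|] [n|] //= mn nm; congr Some; apply/eqP; rewrite eqn_leq mn.
Qed.

Lemma esup_unique (S : set enat) (s : enat) : is_esup S s -> esup S = s.
Proof.
have [ub lub] := esupP S; move=> [ubs lubs].
by apply: enat_le_anti; [apply: lub | apply: lubs].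
Qed.

(* [falgType k]: finite-dimensional associative unital algebras over [k]
   (with 1 != 0); [lmodType A]: left A-modules of arbitrary dimension. *)
Section Modules.
Variables (k : fieldType) (A : falgType k).

(* k acts on an A-module through the scalars [c%:A = c *: 1] of A. *)
Definition fin_dim (M : lmodType A) : Prop :=
  exists (n : nat) (v : 'I_n -> M),
    forall x : M, exists c : 'I_n -> k, x = \sum_(i < n) (c i)%:A *: v i.

Definition mod_iso (M N : lmodType A) : Prop :=
  exists f : {linear M -> N}, bijective f.

(* N is in add(M). *)
Definition in_add (M N : lmodType A) : Prop :=
  exists (n : nat) (N' : lmodType A),
    mod_iso (N * N')%type {ffun 'I_n -> M}.

Definition proj_mod (P : lmodType A) : Prop :=
  fin_dim P /\
  forall (X Y : lmodType A) (g : {linear X -> Y}) (f : {linear P -> Y}),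
    fin_dim X -> fin_dim Y -> (forall y, exists x, g x = y) ->
    exists h : {linear P -> X}, forall p, g (h p) = f p.

Definition inj_mod (I : lmodType A) : Prop :=
  fin_dim I /\
  forall (X Y : lmodType A) (g : {linear X -> Y}) (f : {linear X -> I}),
    fin_dim X -> fin_dim Y -> injective g ->
    exists h : {linear Y -> I}, forall x, h (g x) = f x.

Definition submodule (M : lmodType A) (N : set M) : Prop :=
  N 0 /\ forall (a : A) (x y : M), N x -> N y -> N (a *: x + y).

Definition essential (M : lmodType A) (U : set M) : Prop :=
  submodule U /\
  forall N : set M, submodule N -> (exists2 x, N x & x <> 0) ->
    exists2 x, (N `&` U)%classic x & x <> 0.

(* Minimality: each term is an injective envelope of the kernel of the
   differential leaving it, i.e. of the image of the map entering it. *)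
Record min_inj_resolution (X : lmodType A) := MinInjResolution {
  ir_obj : nat -> lmodType A;
  ir_aug : {linear X -> ir_obj 0%N};
  ir_diff : forall i, {linear ir_obj i -> ir_obj i.+1};
  ir_inj : forall i, inj_mod (ir_obj i);
  ir_aug_inj : injective ir_aug;
  ir_exact0 : forall x, ir_diff 0%N x = 0 <-> exists y, ir_aug y = x;
  ir_exact : forall i x,
    ir_diff i.+1 x = 0 <-> exists y, ir_diff i y = x;
  ir_min : forall i, essential [set x | ir_diff i x = 0]
}.

Record proj_resolution (X : lmodType A) := ProjResolution {
  pr_obj : nat -> lmodType A;
  pr_aug : {linear pr_obj 0%N -> X};
  pr_diff : forall i, {linear pr_obj i.+1 -> pr_obj i};
  pr_proj : forall i, proj_mod (pr_obj i);
  pr_aug_surj : forall x, exists y, pr_aug y = x;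
  pr_exact0 : forall x, pr_aug x = 0 <-> exists y, pr_diff 0%N y = x;
  pr_exact : forall i x,
    pr_diff i x = 0 <-> exists y, pr_diff i.+1 y = x
}.

Definition projdim (X : lmodType A) : enat :=
  einf [set d | exists (n : nat) (Q : proj_resolution X),
    d = Some n /\ forall i, (n < i)%N -> forall x : pr_obj Q i, x = 0].

Definition gldim : enat :=
  esup [set d | exists X : lmodType A, fin_dim X /\ d = projdim X].

Definition domdim : enat :=
  esup [set d | exists (t : nat) (J : min_inj_resolution A^o),
    d = Some t /\ forall i, (i < t)%N -> proj_mod (ir_obj J i)].

Definition generator (M : lmodType A) : Prop := in_add M A^o.

(* D(A_A) = Hom_k(A, k) with the left action (a f)(x) = f(x a). *)
Definition kdual : Type := 'Hom(A, k^o).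
HB.instance Definition _ := GRing.Zmodule.on kdual.
Definition kdual_fun (f : kdual) : A -> k := @fun_of_lfun k A k^o f.

Definition kdual_scale (a : A) (f : kdual) : kdual :=
  linfun (fun_of_lfun f \o *%R^~ a : A -> k^o).

Lemma kdual_scaleE (a : A) (f : kdual) (x : A) :
  kdual_fun (kdual_scale a f) x = kdual_fun f (x * a).
Proof.
pose g : A -> k^o := fun_of_lfun f \o *%R^~ a.
have g_lin : linear g.
  by move=> c u v; rewrite /g /= mulrDl -scalerAl linearP.
pose G : {linear A -> k^o} :=
  HB.pack g (GRing.isLinear.Build k A k^o *:%R g g_lin).
exact: (lfunE G x).
Qed.

Lemma kdual_funP (f g : kdual) : kdual_fun f =1 kdual_fun g -> f = g.
Proof. by move=> fg; apply/lfunP. Qed.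

Lemma kdual_funD (f g : kdual) (x : A) :
  kdual_fun (f + g) x = kdual_fun f x + kdual_fun g x.
Proof. exact: (@add_lfunE k A k^o f g x). Qed.

Fact kdual_scaleA (a b : A) (f : kdual) :
  kdual_scale a (kdual_scale b f) = kdual_scale (a * b) f.
Proof. by apply: kdual_funP => x; rewrite !kdual_scaleE mulrA. Qed.

Fact kdual_scale1 : left_id 1 kdual_scale.
Proof. by move=> f; apply: kdual_funP => x; rewrite kdual_scaleE mulr1. Qed.

Fact kdual_scaleDr : right_distributive kdual_scale +%R.
Proof.
move=> a f g; apply: kdual_funP => x.
by rewrite kdual_scaleE !kdual_funD !kdual_scaleE.
Qed.

Fact kdual_scaleDl (f : kdual) : {morph kdual_scale^~ f : a b / a + b}.
Proof.
move=> a b; apply: kdual_funP => x.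
by rewrite kdual_funD !kdual_scaleE mulrDr [LHS](linearD (f : 'Hom(A, k^o))).
Qed.

HB.instance Definition _ := GRing.Zmodule_isLmodule.Build A kdual
  kdual_scaleA kdual_scale1 kdual_scaleDr kdual_scaleDl.

Definition generator_cogenerator (M : lmodType A) : Prop :=
  in_add M A^o /\ in_add M kdual.

(* A and D(A) are isomorphic A-A-bimodules; the right action on D(A) is
   (f a)(x) = f(a x). *)
Definition symmetric_algebra : Prop :=
  exists f : {linear A^o -> kdual}, bijective f /\
    forall x a y : A, kdual_fun (f (x * a)) y = kdual_fun (f x) (a * y).

(* E is, as a k-algebra, the endomorphism algebra End_A(M), with product the
   composition of maps and k acting through the scalars of A. *)
Definition is_End (M : lmodType A) (E : falgType k) : Prop :=
  exists phi : E -> {linear M -> M},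
    [/\ forall x y, phi x =1 phi y -> x = y,
        forall f : {linear M -> M}, exists x, phi x =1 f,
        forall (c : k) x y m, phi (c *: x + y) m = c%:A *: phi x m + phi y m,
        forall m, phi 1 m = m
      & forall x y m, phi (x * y) m = phi x (phi y m)].

End Modules.

Arguments gldim {k} A.
Arguments domdim {k} A.
Arguments kdual {k} A.
Arguments symmetric_algebra {k} A.

Definition rigdim (k : fieldType) (A : falgType k) : enat :=
  esup [set d | exists (M : lmodType A) (E : falgType k),
    [/\ fin_dim M, generator_cogenerator M, is_End M E,
        gldim E <> einfty & d = domdim E]].

Definition gendo_symmetric (k : fieldType) (A : falgType k) : Prop :=
  exists (L : falgType k) (M : lmodType L),
    [/\ symmetric_algebra L, fin_dim M, generator M & is_End M A].

(* Main.v *)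
Require Import Defs.
From HB Require Import structures.
From mathcomp Require Import all_boot all_algebra all_field.
From mathcomp Require Import boolp classical_sets functions.

(* Let A = End_L(N) with L symmetric and N a generator over L, and let M be a
   generator-cogenerator over A with E = End_A(M).  A minimal injective
   resolution J of E whose first t terms are projective has these terms in
   add(M), so Hom_E(J, M) starts a projective resolution of M over A, and as
   E = Hom_A(M, M) the exactness of J says that Ext^i_A(M, A) = 0, hence
   Ext^i_A(DA, A) = 0, for 1 <= i <= t - 2 (Mueller).  On the other hand the
   symmetrizing form of L yields natural isomorphisms N = Hom_A(DA, N) and
   A = Hom_A(DA, A).  If the terms I^0, ..., I^(i-1) of the minimal injective
   resolution of A lie in add(N), an element x of I^(i-1) whose class modulo
   the image of the previous differential is killed by all maps to N defines a
   map from DA to I^(i-1) landing in that image; it lifts along the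
   differential by the Ext vanishing, and naturality puts x itself in the
   image.  Thus the cokernel embeds in a power of the projective-injective
   A-module N, and so does its injective envelope I^i. *)

Set Implicit Arguments.
Unset Strict Implicit.
Unset Printing Implicit Defensive.

Import GRing.Theory.

Local Open Scope ring_scope.

Section LinearMaps.
Variables (R : nzRingType) (X Y : lmodType R).

Definition mklin (f : X -> Y) (f_lin : linear f) : {linear X -> Y} :=
  HB.pack f (GRing.isLinear.Build R X Y *:%R f f_lin).

End LinearMaps.

(** * Linear algebra over the ground field *)

Section ScalarLinear.
Variables (k : fieldType) (A : falgType k).

Lemma alg_scaleA (c : k) (a : A) (M : lmodType A) (m : M) :
  c%:A *: (a *: m) = a *: (c%:A *: m).
Proof. by rewrite !scalerA mulr_algl mulr_algr. Qed.

Lemma alg_scaleM (M : lmodType A) (a b : k) (m : M) :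
  (a * b)%:A *: m = a%:A *: (b%:A *: m).
Proof. by rewrite scalerA mulr_algl scalerA. Qed.

Lemma alg_scaleD (M : lmodType A) (a b : k) (m : M) :
  (a + b)%:A *: m = a%:A *: m + b%:A *: m.
Proof. by rewrite !scalerDl. Qed.

Lemma alg_scaleB (M : lmodType A) (a b : k) (m : M) :
  (a - b)%:A *: m = a%:A *: m - b%:A *: m.
Proof. by rewrite !scalerBl. Qed.

Definition kfun (M : lmodType A) (f : M -> k) : Prop :=
  forall c x y, f (c%:A *: x + y) = c * f x + f y.

Definition kmap (M N : lmodType A) (f : M -> N) : Prop :=
  forall c x y, f (c%:A *: x + y) = c%:A *: f x + f y.

Section Kfun.
Variables (M : lmodType A) (f : M -> k).
Hypothesis f_lin : kfun f.

Lemma kfunD x y : f (x + y) = f x + f y.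
Proof. by have := f_lin 1 x y; rewrite !scale1r mul1r. Qed.

Lemma kfun0 : f 0 = 0.
Proof. by apply: (addIr (f 0)); rewrite -kfunD !add0r. Qed.

Lemma kfunZ c x : f (c%:A *: x) = c * f x.
Proof. by have := f_lin c x 0; rewrite kfun0 !addr0. Qed.

Lemma kfunB x y : f (x - y) = f x - f y.
Proof.
by apply: (addIr (f y)); rewrite -kfunD !subrK.
Qed.

Lemma kfun_sum (I : finType) (g : I -> M) :
  f (\sum_i g i) = \sum_i f (g i).
Proof. exact: (big_morph f kfunD kfun0). Qed.

End Kfun.

Lemma linear_kmap (M N : lmodType A) (f : {linear M -> N}) : kmap f.
Proof. by move=> c x y; rewrite linearP. Qed.

Lemma kfun_comp (M N : lmodType A) (f : M -> N) (g : N -> k) :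
  kmap f -> kfun g -> kfun (g \o f).
Proof. by move=> f_lin g_lin c x y; rewrite /= f_lin g_lin. Qed.

Lemma kmap_act (M : lmodType A) (m : M) : @kmap A^o M (fun a => a *: m).
Proof. by move=> c x y; rewrite scalerDl scalerA. Qed.

Lemma fin_dim_fin (T : finType) (M : lmodType A) (v : T -> M) :
  (forall x, exists c : T -> k, x = \sum_i (c i)%:A *: v i) -> fin_dim M.
Proof.
move=> vP; exists #|T|, (fun i => v (enum_val i)) => x.
have [c ->] := vP x; exists (fun i => c (enum_val i)).
by rewrite (reindex _ (onW_bij _ (@enum_val_bij T))).
Qed.

(** A spanning family of minimal length is free over [k], so coordinates chosen pointwise are unique
    and hence linear. *)
Lemma fin_dim_frame (M : lmodType A) : fin_dim M ->
  exists (n : nat) (v : 'I_n -> M) (c : 'I_n -> M -> k),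
    (forall i, kfun (c i)) /\ forall x, x = \sum_i (c i x)%:A *: v i.
Proof.
move=> fdM.
pose span n := `[< exists v : 'I_n -> M,
  forall x, exists c : 'I_n -> k, x = \sum_(i < n) (c i)%:A *: v i >].
have ex_span : exists n, span n by case: fdM => n ?; exists n; apply/asboolP.
case: (ex_minnP ex_span) => n /asboolP[v vP] n_min.
have v_free (c : 'I_n -> k) : \sum_i (c i)%:A *: v i = 0 -> forall i, c i = 0.
  move=> c0 i0; apply: contrapT => /eqP ci0.
  suff /n_min : span n.-1 by case: (n) i0 {ci0} => [[]//|m] _; rewrite ltnn.
  case: n v c i0 ci0 c0 vP {n_min ex_span fdM} => [|n] v c i0 ci0 c0 vP.
    by case: i0 ci0.
  apply/asboolP; exists (fun j => v (lift i0 j)) => x.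
  have [d ->] := vP x.
  exists (fun j => d (lift i0 j) - d i0 / c i0 * c (lift i0 j)).
  (* Solving the relation for [v i0] lets the remaining vectors span, against minimality. *)
  have vi0 : v i0 = - \sum_j ((c i0)^-1 * c (lift i0 j))%:A *: v (lift i0 j).
    move: c0; rewrite (bigD1_ord i0) //= => /(canRL (addrK _)).
    rewrite sub0r => /(congr1 ( *:%R (c i0)^-1%:A)).
    rewrite -alg_scaleM mulVf // !scale1r => ->.
    rewrite scalerN scaler_sumr; congr (- _); apply: eq_bigr => j _.
    by rewrite -alg_scaleM.
  rewrite (bigD1_ord i0) //= vi0 scalerN scaler_sumr addrC -sumrB.
  by apply: eq_bigr => j _; rewrite alg_scaleB -alg_scaleM mulrA.
have [c cP] := choice vP.
exists n, v, (fun i x => c x i); split=> // i a x y.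
apply/eqP; rewrite -subr_eq0; apply/eqP.
apply: (v_free (fun i => c (a%:A *: x + y) i - (a * c x i + c y i))).
under eq_bigr do rewrite alg_scaleB alg_scaleD alg_scaleM.
by rewrite sumrB big_split /= -scaler_sumr -!cP subrr.
Qed.

End ScalarLinear.

(** * Coordinates and matrices of [k]-linear maps *)

Section Frames.
Variables (k : fieldType) (A : falgType k).

(* A dual frame; the vectors [fr_vec] need not be independent. *)
Record frame (M : lmodType A) := Frame {
  fr_dim : nat;
  fr_vec : 'I_fr_dim -> M;
  fr_coord : 'I_fr_dim -> M -> k;
  fr_lin : forall i, kfun (fr_coord i);
  fr_sum : forall x, x = \sum_i (fr_coord i x)%:A *: fr_vec i
}.

Lemma ex_frame (M : lmodType A) : fin_dim M -> exists F : frame M, True.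
Proof.
move=> /fin_dim_frame[n [v [c [c_lin vc]]]].
by exists (@Frame M n v c c_lin vc).
Qed.

Definition crow (M : lmodType A) (F : frame M) (x : M) : 'rV[k]_(fr_dim F) :=
  \row_i fr_coord i x.

Definition cvec (M : lmodType A) (F : frame M) (r : 'rV[k]_(fr_dim F)) : M :=
  \sum_i (r 0 i)%:A *: fr_vec i.

Lemma crowK (M : lmodType A) (F : frame M) : cancel (@crow M F) (@cvec M F).
Proof.
by move=> x; rewrite {2}(fr_sum F x); apply: eq_bigr => i _; rewrite mxE.
Qed.

Lemma crow_inj (M : lmodType A) (F : frame M) x :
  (crow F x = 0) -> x = 0.
Proof.
move=> x0; rewrite -(crowK F x) x0 /cvec.
by rewrite big1 // => i _; rewrite mxE !scale0r.
Qed.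

Definition fmx (M N : lmodType A) (F : frame M) (G : frame N) (f : M -> N) :
    'M[k]_(fr_dim F, fr_dim G) :=
  \matrix_(i, j) fr_coord j (f (fr_vec i)).

Lemma kmap_sum (M N : lmodType A) (f : M -> N) (n : nat) (g : 'I_n -> M)
    (c : 'I_n -> k) : kmap f ->
  f (\sum_i (c i)%:A *: g i) = \sum_i (c i)%:A *: f (g i).
Proof.
move=> f_lin; have f0 : f 0 = 0.
  by apply: (addIr (f 0)); have := f_lin 1 0 0; rewrite !scale1r !add0r.
have fD x y : f (x + y) = f x + f y by have := f_lin 1 x y; rewrite !scale1r.
rewrite (big_morph f fD f0); apply: eq_bigr => i _.
by have := f_lin (c i) (g i) 0; rewrite f0 !addr0.
Qed.

Lemma crow_fmx (M N : lmodType A) (F : frame M) (G : frame N) (f : M -> N) x :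
  kmap f -> crow G (f x) = crow F x *m fmx F G f.
Proof.
move=> f_lin; apply/rowP => j; rewrite !mxE {1}(fr_sum F x) kmap_sum //.
rewrite (kfun_sum (@fr_lin _ G j)); apply: eq_bigr => i _.
by rewrite (kfunZ (@fr_lin _ G j)) !mxE.
Qed.

Lemma crow_cvec (M N : lmodType A) (F : frame M) (G : frame N) (f : M -> N) r :
  kmap f -> crow G (f (cvec r)) = r *m fmx F G f.
Proof.
move=> f_lin; apply/rowP => j.
rewrite mxE kmap_sum // (kfun_sum (@fr_lin _ G j)) mxE.
by apply: eq_bigr => i _; rewrite (kfunZ (@fr_lin _ G j)) mxE.
Qed.

Lemma fmx_comp (M N P : lmodType A) (F : frame M) (G : frame N) (H : frame P)
    (f : M -> N) (g : N -> P) : kmap g ->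
  fmx F H (g \o f) = fmx F G f *m fmx G H g.
Proof.
move=> g_lin; apply/row_matrixP => i; rewrite row_mul.
have rowE (P' : lmodType A) (K : frame P') (h : M -> P') :
  row i (fmx F K h) = crow K (h (fr_vec i)) by apply/rowP => j; rewrite !mxE.
by rewrite !rowE (crow_fmx G).
Qed.

(** The matrix [pinvmx] supplies [r], which is only [k]-linear; it replaces a choice of complements
    to the kernel and the image of [u]. *)
Lemma ex_pseudo_inverse (X Y : lmodType A) (u : X -> Y) :
  fin_dim X -> fin_dim Y -> kmap u ->
  exists r : Y -> X, kmap r /\ forall x, u (r (u x)) = u x.
Proof.
move=> /ex_frame[F _] /ex_frame[G _] u_lin.
exists (fun y => cvec (crow G y *m pinvmx (fmx F G u))); split=> [c x y|x].
  rewrite /cvec scaler_sumr -big_split; apply: eq_bigr => i _ /=.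
  rewrite -alg_scaleM -alg_scaleD; congr (_%:A *: _).
  suff -> : crow G (c%:A *: x + y) = c *: crow G x + crow G y.
    by rewrite mulmxDl -scalemxAl !mxE.
  by apply/rowP => j; rewrite !mxE fr_lin.
apply: (can_inj (crowK G)); rewrite crow_cvec // (crow_fmx F G) //.
by rewrite mulmxKpV ?submxMl.
Qed.

(** * Summands of powers, injectivity and projectivity *)

Section Retr.
Implicit Types I M N X Y Z P Q : lmodType A.

(* X lies in add(M). *)
Definition retr M X : Prop := exists n (s : 'I_n -> {linear X -> M})
  (p : 'I_n -> {linear M -> X}), forall x, \sum_i p i (s i x) = x.

(* Injectivity with respect to maps [u] that need not be injective, provided
   [f] kills the kernel of [u]; this avoids the formation of images. *)
Definition injx I : Prop :=
  forall X Y (u : {linear X -> Y}) (f : {linear X -> I}),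
  fin_dim X -> fin_dim Y -> (forall x, u x = 0 -> f x = 0) ->
  exists h : {linear Y -> I}, forall x, h (u x) = f x.

Lemma sum_lin (X Y : lmodType A) n (f : 'I_n -> {linear X -> Y}) :
  linear (fun x => \sum_i f i x).
Proof.
move=> a x y; rewrite scaler_sumr -big_split; apply: eq_bigr => i _.
by rewrite linearP.
Qed.

Definition lcomp X Y Z (g : {linear Y -> Z}) (f : {linear X -> Y}) :
  {linear X -> Z} := g \o f.

Lemma act_lin (M : lmodType A) (m : M) : linear (fun a : A^o => a *: m).
Proof. by move=> a x y; rewrite scalerDl scalerA. Qed.

Definition lact M (m : M) : {linear A^o -> M} := mklin (act_lin m).

Lemma retr_fin (T : finType) M X (s : T -> {linear X -> M})
    (p : T -> {linear M -> X}) : (forall x, \sum_i p i (s i x) = x) -> retr M X.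
Proof.
move=> ps; exists #|T|, (s \o enum_val), (p \o enum_val) => x.
by rewrite -[RHS]ps (reindex _ (onW_bij _ (@enum_val_bij T))).
Qed.

Lemma retr_trans N M X : retr N M -> retr M X -> retr N X.
Proof.
move=> [m [s' [p' ps']]] [n [s [p ps]]].
apply: (@retr_fin _ _ _ (fun ij : 'I_n * 'I_m => lcomp (s' ij.2) (s ij.1))
  (fun ij => lcomp (p ij.1) (p' ij.2))) => x /=.
rewrite -[RHS]ps -(pair_bigA _ (fun i j => p i (p' j (s' j (s i x))))).
by apply: eq_bigr => i _; rewrite -linear_sum ps'.
Qed.

Lemma retr_ffun M (T : finType) : retr M {ffun T -> M}.
Proof.
have s_lin i : linear (fun f : {ffun T -> M} => f i).
  by move=> a f g; rewrite !ffunE.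
have p_lin (i : T) : linear (fun m : M => [ffun j => if j == i then m else 0]).
  move=> a x y; apply/ffunP => j; rewrite !ffunE.
  by case: eqP; rewrite ?scaler0 ?addr0.
apply: (retr_fin (s := fun i => mklin (s_lin i))
  (p := fun i => mklin (p_lin i))) => f /=.
apply/ffunP => j; rewrite sum_ffunE (bigD1 j) //= ffunE eqxx big1 ?addr0 //.
by move=> i /negPf ij; rewrite ffunE eq_sym ij.
Qed.

Lemma in_add_retr M X : in_add M X -> retr M X.
Proof.
move=> [n [N' [f [g fK gK]]]].
have g_lin : linear g.
  by move=> a x y; apply: (can_inj fK); rewrite linearP !gK.
have i_lin : linear (fun x : X => (x, 0) : X * N').
  by move=> a x y; congr pair => /=; rewrite ?scaler0 ?addr0.
have q_lin : linear (fun xy : X * N' => xy.1) by [].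
apply: (retr_trans (retr_ffun M 'I_n)).
exists 1%N, (fun=> lcomp f (mklin i_lin)).
exists (fun=> lcomp (mklin q_lin) (mklin g_lin)).
by move=> x; rewrite big_ord1 /= fK.
Qed.

Lemma retr_fin_dim M X : retr M X -> fin_dim M -> fin_dim X.
Proof.
move=> [n [s [p ps]]] [m [v vP]].
apply: (@fin_dim_fin _ _ _ _ (fun ij : 'I_n * 'I_m => p ij.1 (v ij.2))) => x.
have [c cP] := choice vP; exists (fun ij => c (s ij.1 x) ij.2).
rewrite -[LHS]ps.
rewrite -(pair_bigA _ (fun i j => (c (s i x) j)%:A *: p i (v j))).
apply: eq_bigr => i _; rewrite {1}(cP (s i x)) linear_sum.
by apply: eq_bigr => j _; rewrite linearZ.
Qed.

Lemma retr_injx M X : retr M X -> injx M -> injx X.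
Proof.
move=> [n [s [p ps]]] M_inj Y Z u f fdY fdZ uf.
have /choice[h hP] i : exists h : {linear Z -> M},
    forall x, h (u x) = s i (f x).
  have [//|h hP] := M_inj _ _ u (lcomp (s i) f) fdY fdZ _.
    by move=> x /uf /= ->; rewrite linear0.
  by exists h.
exists (mklin (sum_lin (fun i => lcomp (p i) (h i)))) => x /=.
by under eq_bigr do rewrite hP; rewrite ps.
Qed.

Lemma injx_inj_mod I : fin_dim I -> injx I -> inj_mod I.
Proof.
move=> fdI I_inj; split=> // X Y g f fdX fdY g_inj.
apply: I_inj => // x gx0; suff -> : x = 0 by rewrite linear0.
by apply: g_inj; rewrite gx0 linear0.
Qed.

Lemma lin_regE M (f : {linear A^o -> M}) (a : A) : f a = a *: f 1.
Proof. by rewrite -linearZ /GRing.scale /= mulr1. Qed.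

(** As in [injx], no image is formed: [f] only has to land in the image of [g]. Lifting each
    [f (p i 1)] suffices. *)
Lemma retr_proj_lift P X Y (g : {linear X -> Y}) (f : {linear P -> Y}) :
  retr A^o P -> (forall p, exists x, g x = f p) ->
  exists h : {linear P -> X}, forall p, g (h p) = f p.
Proof.
move=> [n [s [p ps]]] gf.
have /choice[x xP] i := gf (p i 1).
exists (mklin (sum_lin (fun i => lcomp (lact (x i)) (s i)))) => y /=.
rewrite -[in RHS](ps y) !linear_sum; apply: eq_bigr => i _ /=.
by rewrite linearZ xP (lin_regE (p i) (s i y)) linearZ.
Qed.

Lemma fin_dim_reg : @fin_dim k A A^o.
Proof.
exists (\dim {:A}), (fun i => (vbasis {:A})`_i : A^o) => x.
exists (fun i => coord (vbasis {:A}) i x).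
rewrite {1}(coord_vbasis (memvf x)); apply: eq_bigr => i _.
by rewrite /GRing.scale /= mulr_algl.
Qed.

Lemma fin_dim_ffun M (T : finType) : fin_dim M -> fin_dim {ffun T -> M}.
Proof. exact/retr_fin_dim/retr_ffun. Qed.

(** Together the [f i] embed [X] into a power of [M], and this embedding splits because [X] is
    injective. *)
Lemma retr_cogenerated M X (T : finType) (f : T -> {linear X -> M}) :
  fin_dim M -> inj_mod X -> (forall x, (forall i, f i x = 0) -> x = 0) ->
  retr M X.
Proof.
move=> fdM [fdX X_inj] f_inj.
have F_lin : linear (fun x => [ffun i => f i x]).
  by move=> a x y; apply/ffunP => i; rewrite !ffunE linearP.
have id_lin : linear (fun x : X => x) by [].
have [//||x y|h hP] := X_inj _ _ (mklin F_lin) (mklin id_lin).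
- exact: fin_dim_ffun.
- move=> /eqP; rewrite -subr_eq0 -linearB => /eqP/ffunP xy0.
  apply/eqP; rewrite -subr_eq0; apply/eqP/f_inj => i.
  by have := xy0 i; rewrite !ffunE.
apply: (retr_trans (retr_ffun M T)).
by exists 1%N, (fun=> mklin F_lin), (fun=> h) => x; rewrite big_ord1 hP.
Qed.

Lemma fin_dim_pair M N : fin_dim M -> fin_dim N -> fin_dim (M * N)%type.
Proof.
move=> [m [v vP]] [n [w wP]].
pose vw (i : 'I_m + 'I_n) : M * N :=
  match i with inl i => (v i, 0) | inr j => (0, w j) end.
apply: (@fin_dim_fin _ _ _ _ vw) => -[x y].
have [c ->] := vP x; have [d ->] := wP y.
exists (fun i => match i with inl i => c i | inr j => d j end).
rewrite big_sumType /=; congr pair.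
  rewrite [RHS]/= raddf_sum raddf_sum /= [X in _ + X]big1 ?addr0 // => j _.
  by rewrite /= scaler0.
rewrite [RHS]/= raddf_sum raddf_sum /= [X in X + _]big1 ?add0r // => j _.
by rewrite /= scaler0.
Qed.

Lemma comb_lin M n (v : 'I_n -> M) :
  linear (fun w : {ffun 'I_n -> A^o} => \sum_i w i *: v i).
Proof.
move=> a x y; rewrite scaler_sumr -big_split; apply: eq_bigr => i _.
by rewrite !ffunE scalerDl scalerA.
Qed.

(** A finite spanning family over [k] gives a surjection onto [P] from a finite-dimensional free
    module, which splits when [P] is projective. *)
Lemma proj_modP P : proj_mod P <-> fin_dim P /\ retr A^o P.
Proof.
split=> [[fdP P_proj]|[fdP rP]]; last first.
  by split=> // X Y g f _ _ g_surj; apply: retr_proj_lift.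
split=> //; have [n [v vP]] := fdP.
have id_lin : linear (fun p : P => p) by [].
have [||p|h hP] := P_proj _ _ (mklin (comb_lin v)) (mklin id_lin).
- exact/fin_dim_ffun/fin_dim_reg.
- by [].
- have [c cP] := vP p; exists [ffun i => (c i)%:A].
  by rewrite /= {1}cP; apply: eq_bigr => i _; rewrite ffunE.
apply: (retr_trans (retr_ffun A^o 'I_n)).
by exists 1%N, (fun=> h), (fun=> mklin (comb_lin v)) => x; rewrite big_ord1 hP.
Qed.

End Retr.

End Frames.

(** * Duality, injectivity of DA and injective envelopes *)

Section Dual.
Variables (k : fieldType) (A : falgType k).
Implicit Types I M N X Y Z P Q : lmodType A.

Lemma ex_kdual (g : A -> k) :
  @kfun k A A^o g -> exists f : kdual A, forall a, kdual_fun f a = g a.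
Proof.
move=> g_lin; have G_lin : linear (g : A -> k^o).
  by move=> c x y; have := g_lin c x y; rewrite {1}/GRing.scale /= mulr_algl.
by exists (linfun (mklin G_lin) : kdual A) => a; rewrite /kdual_fun lfunE.
Qed.

Lemma kdual_fun_lin (f : kdual A) : @kfun k A A^o (kdual_fun f).
Proof.
move=> c x y; rewrite {1}/GRing.scale /= mulr_algl.
by rewrite /kdual_fun (linearP (f : 'Hom(A, k^o))).
Qed.

Lemma kdual_fun0 (a : A) : kdual_fun (0 : kdual A) a = 0.
Proof. by apply: (addIr (kdual_fun 0 a)); rewrite -kdual_funD !add0r. Qed.

Lemma kdual_ev_lin (a : A) : @kfun k A (kdual A) (fun f => kdual_fun f a).
Proof.
move=> c f g; rewrite kdual_funD kdual_scaleE mulr_algr; congr (_ + _).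
by have := kfunZ (kdual_fun_lin f) c a; rewrite {1}/GRing.scale /= mulr_algl.
Qed.

(** One direction of the adjunction Hom_k(M, k) = Hom_A(M, DA). *)
Lemma ex_dual_map M (l : M -> k) : kfun l ->
  exists h : {linear M -> kdual A}, forall m a, kdual_fun (h m) a = l (a *: m).
Proof.
move=> l_lin; have /choice[h hP] m : exists f : kdual A,
    forall a, kdual_fun f a = l (a *: m).
  by apply: ex_kdual; apply: (kfun_comp (kmap_act m) l_lin).
have h_lin : linear h.
  move=> a x y; apply: kdual_funP => b.
  by rewrite kdual_funD kdual_scaleE !hP scalerDr scalerA (kfunD l_lin).
by exists (mklin h_lin).
Qed.

(** Embeds the cokernel of [d] into a power of DA without forming it: for a pseudo-inverse [r], the
    element [y - d (r y)] vanishes exactly when [y] lies in the image of [d], and its coordinates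
    are functionals that yield the [h i]. *)
Lemma ex_image_equations X Y (d : {linear X -> Y}) : fin_dim X -> fin_dim Y ->
  exists n (h : 'I_n -> {linear Y -> kdual A}),
    (forall i x, h i (d x) = 0) /\
    (forall y, (forall i, kdual_fun (h i y) 1 = 0) -> exists x, d x = y).
Proof.
move=> fdX fdY; have [F _] := ex_frame fdY.
have [r [r_lin rP]] := ex_pseudo_inverse fdX fdY (linear_kmap d).
have l_lin i : kfun (fun y => fr_coord (f := F) i (y - d (r y))).
  move=> c x y; rewrite -(@fr_lin _ _ _ F i) r_lin linearP scalerBr opprD.
  by rewrite -!addrA; congr (fr_coord _ (_ + _)); rewrite addrCA.
have /choice[h hP] i := ex_dual_map (l_lin i).
exists (fr_dim F), h; split=> [i x|y hy0].
  apply: kdual_funP => a; rewrite hP -linearZ rP subrr.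
  by rewrite (kfun0 (@fr_lin _ _ _ F i)) kdual_fun0.
exists (r y); apply/esym/eqP; rewrite -subr_eq0; apply/eqP.
apply: (@crow_inj _ _ _ F); apply/rowP => i; rewrite !mxE.
by have := hy0 i; rewrite hP scale1r.
Qed.

(** By the adjunction it is enough to extend the functional [f] followed by evaluation at 1, which a
    pseudo-inverse of [u] does over [k]. *)
Lemma kdual_injx : injx (kdual A).
Proof.
move=> X Y u f fdX fdY uf.
have [r [r_lin rP]] := ex_pseudo_inverse fdX fdY (linear_kmap u).
have l_lin : kfun (fun y => kdual_fun (f (r y)) 1).
  exact: (kfun_comp r_lin (kfun_comp (linear_kmap f) (kdual_ev_lin 1))).
have [h hP] := ex_dual_map l_lin; exists h => x; apply: kdual_funP => a.
rewrite hP -linearZ; set x' := a *: x.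
have -> : f (r (u x')) = f x'.
  by apply/eqP; rewrite -subr_eq0 -linearB uf // linearB rP subrr.
by rewrite linearZ kdual_scaleE mul1r.
Qed.

Lemma fin_dim_kdual : fin_dim (kdual A).
Proof.
have [F _] := ex_frame (@fin_dim_reg k A).
have /choice[e eP] i := ex_kdual (@fr_lin _ _ _ F i).
exists (fr_dim F), e => f.
exists (fun i => kdual_fun f (fr_vec (f := F) i : A)).
apply: kdual_funP => a.
rewrite (kfun_sum (kdual_ev_lin a)) {1}(fr_sum F a).
rewrite (kfun_sum (kdual_fun_lin f)); apply: eq_bigr => i _.
rewrite (kfunZ (kdual_ev_lin a)) (kfunZ (kdual_fun_lin f)).
by rewrite eP mulrC.
Qed.

(* A linear map [e] fixing the image of [d] and of minimal rank is bijective on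
   its own image, hence yields a projection onto that image; a submodule of
   that image missing the image of [d] could be killed by a further
   endomorphism, lowering the rank. *)
Lemma ex_envelope Q I (d : {linear I -> Q}) :
  fin_dim I -> fin_dim Q -> injx Q ->
  exists p : {linear Q -> Q}, [/\ forall x, p (p x) = p x,
    forall x, p (d x) = d x
    & forall s, p s = s -> s <> 0 ->
        exists (a : A) (x : I), a *: s = d x /\ d x <> 0].
Proof.
move=> fdI fdQ Q_inj; have [F _] := ex_frame fdQ.
pose fixing n := `[< exists e : {linear Q -> Q},
  (forall x, e (d x) = d x) /\ \rank (fmx F F e) = n >].
have id_lin : linear (fun x : Q => x) by [].
have ex_fixing : exists n, fixing n.
  exists (\rank (fmx F F (mklin id_lin))); apply/asboolP.
  by exists (mklin id_lin).
case: (ex_minnP ex_fixing) => n /asboolP[e [ed e_rk]] n_min.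
(* [g] after [e] again fixes the image of [d], so by minimality composing with [g] does not lower
   the rank; hence [g] is injective on the image of [e]. *)
have rk_comp (g : {linear Q -> Q}) : (forall x, g (d x) = d x) ->
    \rank (fmx F F e *m fmx F F g) = \rank (fmx F F e).
  move=> gd; apply/eqP; rewrite eqn_leq mxrankM_maxl e_rk n_min //.
  apply/asboolP; exists (lcomp g e); split=> [x|]; first by rewrite /= ed gd.
  by rewrite -(fmx_comp F F F) //; apply: linear_kmap.
have ker_comp (g : {linear Q -> Q}) x : (forall x, g (d x) = d x) ->
    g (e x) = 0 -> e x = 0.
  move=> gd ge0; apply: (@crow_inj _ _ _ F); rewrite (crow_fmx F); last first.
    exact: linear_kmap.
  have ge0' : (crow F x *m fmx F F e) *m fmx F F g = 0.
    rewrite -!crow_fmx; try exact: linear_kmap.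
    rewrite ge0; apply/rowP => i; rewrite !mxE.
    exact: (kfun0 (@fr_lin _ _ _ F i)).
  apply/eqP; rewrite -submx0.
  have /mxrank_injP/eqP <- := rk_comp g gd.
  by rewrite sub_capmx submxMl; apply/sub_kermxP.
have im_e x : exists z, e x = e (e z).
  have /submxP[D DP] : (fmx F F e <= fmx F F e *m fmx F F e)%MS.
    rewrite -(mxrank_leqif_sup (submxMl (fmx F F e) (fmx F F e))).2.
    by rewrite rk_comp.
  exists (cvec (crow F x *m D)); apply: (can_inj (crowK F)).
  have e_k := linear_kmap e.
  rewrite (crow_fmx F) // (crow_fmx F F _ e_k) crow_cvec //.
  by rewrite -!mulmxA -DP.
have e_inj z1 z2 : e (e z1) = e (e z2) -> e z1 = e z2.
  move=> /eqP; rewrite -subr_eq0 -!linearB => /eqP/(ker_comp e _ ed)/eqP.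
  by rewrite linearB subr_eq0 => /eqP.
(* [p] is [e] followed by the inverse of the restriction of [e] to its own image. *)
have /choice[p pP] x : exists y, (exists z, y = e z) /\ e y = e x.
  by have [z zP] := im_e x; exists (e z); split=> //; exists z.
have p_uniq x z : e (e z) = e x -> p x = e z.
  by have [[w ->] <-] := pP x => /e_inj.
have p_lin : linear p.
  move=> a x y; have [[zx zxP] ex] := pP x; have [[zy zyP] ey] := pP y.
  rewrite zxP zyP -linearP; apply: p_uniq.
  by rewrite !linearP -zxP -zyP ex ey.
have p_im x : exists z, p x = e z by have [] := pP x.
exists (mklin p_lin); split=> [x|x|s ps s0] /=.
- by have [z ->] := p_im x; apply: p_uniq.
- by rewrite -{2}(ed x); apply: p_uniq; rewrite !ed.
apply: contrapT => no_as.
(* If no multiple of [s] is a nonzero [d x], then sending [d x + a *: s] to [d x] is well defined.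
   Its extension [h] to [Q] fixes the image of [d] and kills [s], which contradicts [ker_comp]. *)
have as_lin : linear (fun xa : I * A^o => d xa.1 + xa.2 *: s).
  move=> a [x b] [y c] /=; rewrite linearP scalerDr scalerDl scalerA.
  by rewrite -!addrA; congr (_ + _); rewrite addrCA.
have dx_lin : linear (fun xa : I * A^o => d xa.1).
  by move=> a [x b] [y c] /=; rewrite linearP.
have [||[x a] /= xa0|h hP] := Q_inj _ _ (mklin as_lin) (mklin dx_lin).
- exact/fin_dim_pair/fin_dim_reg.
- exact: fdQ.
- apply: contrapT => dx0; apply: no_as; exists (- a), x; split=> //.
  by rewrite scaleNr; apply/esym/eqP; rewrite -addr_eq0 xa0.
have hd x : h (d x) = d x by have := hP (x, 0); rewrite /= scale0r addr0.
have hs : h s = 0 by have := hP (0, 1); rewrite /= linear0 scale1r add0r.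
have {}ps : p s = s by [].
have [z] := p_im s; rewrite ps => ez.
by apply: s0; rewrite ez; apply: (ker_comp h) => //; rewrite -ez hs.
Qed.

End Dual.

(** * Minimal injective resolutions *)

Section FixedSubmodule.
Variables (k : fieldType) (A : falgType k) (Q : lmodType A).
Variable p : {linear Q -> Q}.

Definition fixed_pred : {pred Q} := fun x => p x == x.

Fact fixed_submod : submod_closed fixed_pred.
Proof.
split=> [|a x y]; first by rewrite /in_mem /= /fixed_pred linear0.
by rewrite /in_mem /= /fixed_pred => /eqP px /eqP py; rewrite linearP px py.
Qed.
HB.instance Definition _ :=
  GRing.isSubmodClosed.Build A Q fixed_pred fixed_submod.

(** For idempotent [p] this is the image of [p], hence a summand of [Q]. *)
Record fixmod := FixMod { fixval :> Q; _ : fixval \in fixed_pred }.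
HB.instance Definition _ := [isSub for fixval].
HB.instance Definition _ := [Choice of fixmod by <:].
HB.instance Definition _ := [SubChoice_isSubLmodule of fixmod by <:].

Lemma fixvalP (x : fixmod) : p (fixval x) = fixval x.
Proof. by apply/eqP; case: x. Qed.

Lemma fixval_inj : injective fixval.
Proof. exact: val_inj. Qed.

Lemma fixval_lin : linear fixval.
Proof. by []. Qed.

Lemma ex_corestrict (X : lmodType A) (f : {linear X -> Q}) :
  (forall x, p (f x) = f x) ->
  exists g : {linear X -> fixmod}, forall x, fixval (g x) = f x.
Proof.
move=> pf; have fP x : f x \in fixed_pred by apply/eqP.
have g_lin : linear (fun x => FixMod (fP x)).
  by move=> a x y; apply: val_inj; rewrite /= linearP.
by exists (mklin g_lin).
Qed.

Lemma fixmod_retr : (forall x, p (p x) = p x) -> retr Q fixmod.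
Proof.
move=> pp; have [g gP] := ex_corestrict pp.
exists 1%N, (fun=> mklin fixval_lin), (fun=> g) => x.
by rewrite big_ord1; apply: fixval_inj; rewrite gP fixvalP.
Qed.

End FixedSubmodule.

Section Resolution.
Variables (k : fieldType) (A : falgType k).

(** An injective envelope of the cokernel of [u], which is not formed itself; essentiality is stated
    elementwise. *)
Record inj_step (X Y : lmodType A) (u : {linear X -> Y}) := InjStep {
  is_obj : lmodType A;
  is_map : {linear Y -> is_obj};
  is_fin_dim : fin_dim is_obj;
  is_injx : injx is_obj;
  is_exact : forall y, is_map y = 0 <-> exists x, u x = y;
  is_ess : forall z, z <> 0 -> exists a y, a *: z = is_map y /\ is_map y <> 0
}.

(** The equations of the image of [u] map [Y] to a power of DA, which is then cut down to the
    summand given by [ex_envelope]. *)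
Lemma ex_inj_step (X Y : lmodType A) (u : {linear X -> Y}) :
  fin_dim X -> fin_dim Y -> exists s : inj_step u, True.
Proof.
move=> fdX fdY; have [n [h [hu h_im]]] := ex_image_equations u fdX fdY.
have D_lin : linear (fun y => [ffun i => h i y]).
  by move=> a x y; apply/ffunP => i; rewrite !ffunE linearP.
have retrQ := retr_ffun (kdual A) 'I_n.
have fdQ := retr_fin_dim retrQ (@fin_dim_kdual k A).
have Q_inj := retr_injx retrQ (@kdual_injx k A).
have [p [pp pD p_ess]] := ex_envelope (mklin D_lin) fdY fdQ Q_inj.
have [d dP] := ex_corestrict pD.
have dE y i : fixval (d y) i = h i y by rewrite dP /= ffunE.
have retrU := fixmod_retr pp.
have d_exact y : d y = 0 <-> exists x, u x = y.
  split=> [dy0|[x <-]].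
    by apply: h_im => i; rewrite -dE dy0 ffunE kdual_fun0.
  by apply: fixval_inj; apply/ffunP => i; rewrite dE hu ffunE.
have d_ess z : z <> 0 -> exists a y, a *: z = d y /\ d y <> 0.
  move=> z0; have [||a [y [zy dy0]]] := p_ess (fixval z).
  - exact: fixvalP.
  - by move=> z0'; apply: z0; apply: fixval_inj; rewrite z0'.
  exists a, y; split; first by apply: fixval_inj; rewrite dP -zy.
  by move=> /(congr1 (@fixval _ _ _ _)); rewrite dP.
by exists (InjStep (retr_fin_dim retrU fdQ) (retr_injx retrU Q_inj)
  d_exact d_ess).
Qed.

(** Bundling a map with its two modules makes the construction of the resolution an iteration on one
    type. *)
Record stage := Stage {
  st_dom : lmodType A;
  st_cod : lmodType A;
  st_map : {linear st_dom -> st_cod};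
  st_dom_fd : fin_dim st_dom;
  st_cod_fd : fin_dim st_cod
}.

Definition stage_step (s : stage) : inj_step (st_map s) :=
  sval (cid (ex_inj_step (st_map s) (st_dom_fd s) (st_cod_fd s))).

Definition next_stage (s : stage) : stage :=
  Stage (is_map (stage_step s)) (st_cod_fd s) (is_fin_dim (stage_step s)).

Lemma step_essential (X Y : lmodType A) (u : {linear X -> Y}) (s : inj_step u)
    (U : set (is_obj s)) :
  (forall z, U z <-> exists y, is_map s y = z) -> essential U.
Proof.
move=> UP; split=> [|N [N0 N_lin] [x Nx x0]].
  split; first by apply/UP; exists 0; rewrite linear0.
  move=> a x y /UP[x' <-] /UP[y' <-]; apply/UP.
  by exists (a *: x' + y'); rewrite linearP.
have [a [y [axy dy0]]] := is_ess x0; exists (a *: x); last by rewrite axy.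
split; last by apply/UP; exists y.
by rewrite -[a *: x]addr0; apply: N_lin.
Qed.

Lemma ex_min_inj_resolution (X : lmodType A) : fin_dim X ->
  exists J : min_inj_resolution X, forall i, injx (ir_obj J i).
Proof.
move=> fdX; have zero_lin : linear (fun _ : X => 0 : X).
  by move=> a x y; rewrite scaler0 addr0.
(* The zero map on [X] has cokernel [X], so the first step is the envelope of [X]. Thus stage 0
   holds the augmentation and stage [i.+1] the differential [i]. *)
pose S i := iter i next_stage (next_stage (Stage (mklin zero_lin) fdX fdX)).
pose St i := stage_step (S i).
have S_inj i : injx (st_cod (S i)).
  by case: i => [|i]; apply: is_injx.
have aug_inj : injective (st_map (S 0%N)).
  move=> x y /eqP; rewrite -subr_eq0 -linearB => /eqP/is_exact[z /= xy].
  by apply/eqP; rewrite -subr_eq0 -xy.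
have exact0 x : st_map (S 1%N) x = 0 <-> exists y, st_map (S 0%N) y = x.
  exact: is_exact.
have exact1 i x : st_map (S i.+2) x = 0 <-> exists y, st_map (S i.+1) y = x.
  exact: is_exact.
have ess i : essential [set x | st_map (S i.+1) x = 0].
  by case: i => [|i]; apply: step_essential => z; apply: is_exact.
exists (@MinInjResolution k A X (fun i => st_cod (S i)) (st_map (S 0%N))
  (fun i => st_map (S i.+1)) (fun i => injx_inj_mod (st_cod_fd (S i)) (S_inj i))
  aug_inj exact0 exact1 ess).
exact: S_inj.
Qed.

End Resolution.

(** * Modules over endomorphism algebras *)

Section EndModule.
Variables (k : fieldType).

Record endR (B : falgType k) (M : lmodType B) (E : falgType k) := EndR {
  er_act : E -> {linear M -> M};
  er_inj : forall x y, er_act x =1 er_act y -> x = y;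
  er_surj : forall f : {linear M -> M}, exists x, er_act x =1 f;
  er_lin : forall (c : k) x y m,
    er_act (c *: x + y) m = c%:A *: er_act x m + er_act y m;
  er_one : forall m, er_act 1 m = m;
  er_mul : forall x y m, er_act (x * y) m = er_act x (er_act y m)
}.

Lemma is_EndP (B : falgType k) (M : lmodType B) (E : falgType k) :
  is_End M E -> exists r : endR M E, True.
Proof. by move=> [f [f1 f2 f3 f4 f5]]; exists (EndR f1 f2 f3 f4 f5). Qed.

Variables (B : falgType k) (M : lmodType B) (E : falgType k) (r : endR M E).

(** A copy of [M] carrying the action of [E]; the argument [r] lets the module structure depend on
    the chosen identification of [E] with End(M). *)
Definition emod of endR M E : Type := M.
HB.instance Definition _ := GRing.Zmodule.on (emod r).

Definition emod_scale (e : E) (m : emod r) : emod r := er_act r e m.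

Fact emod_scaleA (a b : E) (m : emod r) :
  emod_scale a (emod_scale b m) = emod_scale (a * b) m.
Proof. by rewrite /emod_scale er_mul. Qed.

Fact emod_scale1 : left_id 1 emod_scale.
Proof. exact: er_one. Qed.

Fact emod_scaleDr : right_distributive emod_scale +%R.
Proof. by move=> a x y; rewrite /emod_scale linearD. Qed.

Fact emod_scaleDl (m : emod r) : {morph emod_scale^~ m : a b / a + b}.
Proof.
by move=> a b; have := er_lin r 1 a b m; rewrite !scale1r.
Qed.

HB.instance Definition _ := GRing.Zmodule_isLmodule.Build E (emod r)
  emod_scaleA emod_scale1 emod_scaleDr emod_scaleDl.

Lemma emodE (e : E) (m : emod r) : e *: m = er_act r e m.
Proof. by []. Qed.

Lemma emod_alg (c : k) (m : emod r) : c%:A *: m = c%:A *: (m : M).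
Proof.
rewrite emodE; have := er_lin r c 1 0 m; rewrite addr0 => ->.
rewrite er_one; suff -> : er_act r 0 m = 0 by rewrite addr0.
exact: (scale0r (m : emod r)).
Qed.

Lemma emod_comm (e : E) (b : B) (m : M) :
  e *: (b *: m : emod r) = b *: (e *: (m : emod r) : M).
Proof. by rewrite emodE linearZ. Qed.

Lemma emod_kfun (f : M -> k) : kfun f <-> @kfun k E (emod r) f.
Proof. by split=> f_lin c x y; have := f_lin c x y; rewrite emod_alg. Qed.

Lemma emod_fin_dim : fin_dim M -> fin_dim (emod r).
Proof.
move=> [n [v vP]]; exists n, v => x; have [c {1}->] := vP x; exists c.
by apply: eq_bigr => i _; rewrite emod_alg.
Qed.

Lemma emod_ext (x y : E) : (forall m : emod r, x *: m = y *: m) -> x = y.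
Proof. by move=> xy; apply: (er_inj (e := r)) => m; apply: xy. Qed.

Lemma ex_emod (f : {linear M -> M}) :
  exists e : E, forall m : emod r, e *: m = f m.
Proof. by have [e eP] := er_surj r f; exists e. Qed.

Section Generator.
Hypothesis M_gen : retr M B^o.

Lemma emod_faithful (b : B) : (forall m : M, b *: m = 0) -> b = 0.
Proof.
move=> b0; have [n [s [p ps]]] := M_gen.
rewrite -(ps b) big1 // => i _.
by rewrite lin_regE b0 linear0.
Qed.

(** Double centralizer property of a generator. Write 1 as the sum of the [p i (s i 1)]; the map
    sending [x] to [p i x *: m] belongs to [E], so [f] commutes with it. *)
Lemma emod_end (f : {linear emod r -> emod r}) :
  exists b : B, forall m, f m = b *: (m : M).
Proof.
have [n [s [p ps]]] := M_gen.
exists (\sum_i p i (f (s i 1))) => m.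
have mE : (m : emod r) = \sum_i (p i (s i 1) *: (m : M) : emod r).
  have := scaler_suml (m : M) (index_enum _) xpredT (fun i => p i (s i 1) : B).
  by rewrite ps scale1r.
rewrite scaler_suml [in LHS]mE linear_sum; apply: eq_bigr => i _.
have [e eP] := ex_emod (lcomp (lact (m : M)) (p i)).
by rewrite -[RHS](eP (f (s i 1))) -linearZ eP.
Qed.

(** A generator is projective over its endomorphism algebra: the [s i 1] and the maps sending [m] to
    the endomorphism [p i _ *: m] form a dual basis. *)
Lemma emod_retr_reg : retr E^o (emod r).
Proof.
have [n [s [p ps]]] := M_gen.
have /choice[t tP] (i : 'I_n) : exists t : emod r -> E,
    forall m (x : emod r), t m *: x = p i x *: (m : M).
  have /choice[t tP] (m : emod r) := ex_emod (lcomp (lact (m : M)) (p i)).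
  by exists t.
have t_lin i : @linear_for E (emod r) E^o *:%R (t i).
  move=> a x y; apply: emod_ext => m.
  by rewrite scalerDl -scalerA !tP scalerDr emod_comm.
exists n, (fun i => mklin (t_lin i)), (fun i => lact (s i 1 : emod r)) => m.
have mE : (m : emod r) = \sum_i (p i (s i 1) *: (m : M) : emod r).
  have := scaler_suml (m : M) (index_enum _) xpredT (fun i => p i (s i 1) : B).
  by rewrite ps scale1r.
by rewrite [RHS]mE; apply: eq_bigr => i _; rewrite -tP.
Qed.

End Generator.

(** A projective module embeds in a power of [E], and [E] embeds in a power of [M] by evaluation at
    a frame; injectivity of [X] splits the composite. *)
Lemma proj_inj_retr_emod (X : lmodType E) :
  fin_dim M -> proj_mod X -> inj_mod X -> retr (emod r) X.
Proof.
move=> fdM /proj_modP[_ [n [s [p ps]]]] X_inj.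
have [F _] := ex_frame fdM.
apply: (@retr_cogenerated _ _ _ _ _ (fun ij : 'I_n * 'I_(fr_dim F) =>
  lcomp (lact (fr_vec ij.2 : emod r)) (s ij.1))) => //.
  exact: emod_fin_dim.
move=> x x0; rewrite -(ps x) big1 // => i _.
suff -> : s i x = 0 by rewrite linear0.
apply: emod_ext => m; rewrite scale0r.
rewrite (fr_sum F (m : M)) linear_sum big1 // => j _.
by rewrite linearZ; have := x0 (i, j); rewrite /= emodE => ->; rewrite scaler0.
Qed.

(* If DB is a summand of a power of M, then M is a summand of a power of DE. *)
Lemma emod_injx : fin_dim M -> retr M (kdual B) -> injx (emod r).
Proof.
move=> fdM [n [al [be abP]]]; have [F _] := ex_frame fdM.
have /choice[hat hatP] j := ex_dual_map (@fr_lin _ _ _ F j).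
have /choice[eps epsP] (ij : 'I_n * 'I_(fr_dim F)) :=
  ex_emod (lcomp (al ij.1) (hat ij.2)).
pose P i (g : kdual E) : emod r :=
  \sum_j (kdual_fun g (eps (i, j)))%:A *: (fr_vec j : M).
(* A description of [P i g] by its values under functionals. Leaving [h] and [w] free allows its use
   for the functional [l (e *: _)] in the proof that [P i] is linear. *)
have PE i g (l : M -> k) (h : M -> kdual B) (w : E) : kfun l ->
    (forall m b, kdual_fun (h m) b = l (b *: m)) ->
    (forall m : emod r, w *: m = al i (h m)) -> l (P i g) = kdual_fun g w.
  move=> l_lin hP wP; rewrite (kfun_sum l_lin).
  suff -> : w = \sum_j l (fr_vec j) *: eps (i, j).
    rewrite (kfun_sum (kdual_fun_lin g)); apply: eq_bigr => j _.
    rewrite (kfunZ l_lin) mulrC -mulr_algl.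
    exact/esym/(kfunZ (kdual_fun_lin g)).
  apply: emod_ext => m; rewrite wP scaler_suml.
  under eq_bigr do rewrite -mulr_algl -scalerA epsP emod_alg /=.
  transitivity (al i (\sum_j (l (fr_vec j))%:A *: hat j (m : M))); last first.
    by rewrite linear_sum; apply: eq_bigr => j _; rewrite linearZ.
  congr (al i _); apply: kdual_funP => b.
  rewrite hP {1}(fr_sum F (b *: m)) (kfun_sum l_lin).
  rewrite (kfun_sum (kdual_ev_lin b)); apply: eq_bigr => j _.
  by rewrite (kfunZ (kdual_ev_lin b)) (kfunZ l_lin) hatP mulrC.
have c_inj (x y : M) :
    (forall j, fr_coord (f := F) j x = fr_coord (f := F) j y) -> x = y.
  move=> xy; rewrite (fr_sum F x) (fr_sum F y).
  by apply: eq_bigr => j _; rewrite xy.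
have cP i j g := PE i g _ _ _ (@fr_lin _ _ _ F j) (hatP j) (epsP (i, j)).
have P_lin i : linear (P i).
  move=> e g g'; apply: c_inj => j; rewrite cP kdual_funD kdual_scaleE.
  rewrite (kfunD (@fr_lin _ _ _ F j)) cP; congr (_ + _).
  apply/esym; apply: (PE i g (fun m => fr_coord j (e *: (m : emod r)))
    (fun m => hat j (e *: (m : emod r)))).
  - by move=> c x y; rewrite !emodE linearP (@fr_lin _ _ _ F j).
  - by move=> m b; rewrite hatP -emod_comm.
  - by move=> m; rewrite -scalerA epsP.
have S_lin i : @kfun k E (emod r) (fun m => kdual_fun (be i m) 1).
  apply/emod_kfun.
  exact: (kfun_comp (linear_kmap (be i)) (@kdual_ev_lin k B 1)).
have /choice[S SP] i := ex_dual_map (S_lin i).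
apply: retr_injx (@kdual_injx k E).
exists n, S, (fun i => mklin (P_lin i)) => m.
apply: c_inj => j; rewrite (kfun_sum (@fr_lin _ _ _ F j)).
under eq_bigr do rewrite /= cP SP epsP /=.
have := abP (hat j m) => /(congr1 (fun f => kdual_fun f 1)).
rewrite (kfun_sum (@kdual_ev_lin k B 1)) => ->.
by rewrite hatP scale1r.
Qed.

End EndModule.

(** * The [B]-module Hom_E(J, M) *)

Section HomModule.
Variables (k : fieldType) (B : falgType k) (M : lmodType B) (E : falgType k).
Variables (r : endR M E) (J : lmodType E).

Definition hom_pred : {pred (J -> M)} :=
  fun f => `[< @linear_for E J (emod r) *:%R f >].

Fact hom_submod : submod_closed hom_pred.
Proof.
split=> [|b f g /asboolP f_lin /asboolP g_lin]; apply/asboolP => e x y.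
  by rewrite scaler0 addr0.
change (b *: f (e *: x + y) + g (e *: x + y) =
  e *: (b *: f x + g x : emod r) + (b *: f y + g y)).
rewrite f_lin g_lin scalerDr [in RHS]scalerDr emod_comm.
by rewrite -!addrA; congr (_ + _); rewrite addrCA.
Qed.
HB.instance Definition _ :=
  GRing.isSubmodClosed.Build B (J -> M) hom_pred hom_submod.

Record homE := HomE { hom_fun :> J -> M; _ : hom_fun \in hom_pred }.
HB.instance Definition _ := [isSub for hom_fun].
HB.instance Definition _ := [Choice of homE by <:].
HB.instance Definition _ := [SubChoice_isSubLmodule of homE by <:].

Lemma homE_lin (h : homE) : @linear_for E J (emod r) *:%R h.
Proof. by apply/asboolP; case: h. Qed.

Definition hom_lin (h : homE) : {linear J -> emod r} := mklin (@homE_lin h).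

Lemma homE_ext (h h' : homE) : h =1 h' -> h = h'.
Proof. by move=> hh'; apply: val_inj; apply/funext. Qed.

Lemma homE_comb (b : B) (h h' : homE) x : (b *: h + h') x = b *: h x + h' x.
Proof. by []. Qed.

Lemma homE_sum (I : finType) (h : I -> homE) x : (\sum_i h i) x = \sum_i h i x.
Proof. by apply: (big_morph (fun h : homE => h x)). Qed.

Lemma ex_homE (f : {linear J -> emod r}) : exists h : homE, h =1 f.
Proof.
have fP : (f : J -> M) \in hom_pred by apply/asboolP => e x y; rewrite linearP.
by exists (HomE fP).
Qed.

Lemma hom_eval_lin (x : J) : linear (fun h : homE => h x).
Proof. by []. Qed.

End HomModule.

Section HomRetract.
Variables (k : fieldType) (B : falgType k) (M : lmodType B) (E : falgType k).
Variables (r : endR M E) (J : lmodType E).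
Hypotheses (M_gen : retr M B^o) (J_retr : retr (emod r) J).

(** Reduces to Hom_E(M, M), which is [B] by [emod_end]. *)
Lemma homE_retr_reg : retr B^o (homE r J).
Proof.
have [n [s [p ps]]] := J_retr.
have /choice[S SP] (i : 'I_n) : exists S : homE r J -> B,
    forall (h : homE r J) m, h (p i m) = S h *: (m : M).
  by have /choice[S SP] (h : homE r J) :=
       emod_end M_gen (lcomp (hom_lin h) (p i)); exists S.
have S_lin i : @linear_for B (homE r J) B^o *:%R (S i).
  move=> b h h'; apply/eqP; rewrite -subr_eq0; apply/eqP.
  apply: (emod_faithful M_gen) => m.
  by rewrite scalerBl -SP scalerDl -scalerA -!SP homE_comb subrr.
have /choice[s' s'P] i := ex_homE (s i).
exists n, (fun i => mklin (S_lin i)), (fun i => lact (s' i)) => h.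
apply: homE_ext => x; rewrite homE_sum.
transitivity (hom_lin h (\sum_i p i (s i x))); last by rewrite ps.
rewrite linear_sum; apply: eq_bigr => i _.
by rewrite [RHS](SP i h) -s'P.
Qed.

(** Surjectivity of the evaluation map from [J] to the [M]-bidual, inherited by summands of powers
    from the case of [M], where Hom_E(M, M) = B. *)
Lemma homE_bidual (f : {linear homE r J -> M}) :
  exists x : J, forall h : homE r J, f h = h x.
Proof.
have [n [s [p ps]]] := J_retr.
have /choice[s' s'P] i := ex_homE (s i).
exists (\sum_i p i (f (s' i))) => h.
have /choice[b bP] i := emod_end M_gen (lcomp (hom_lin h) (p i)).
transitivity (\sum_i b i *: f (s' i)); last first.
  transitivity (hom_lin h (\sum_i p i (f (s' i)))) => //.
  by rewrite linear_sum; apply: eq_bigr => i _; rewrite -bP.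
under eq_bigr do rewrite -linearZ.
rewrite -linear_sum; congr (f _); apply: homE_ext => x; rewrite homE_sum.
transitivity (hom_lin h (\sum_i p i (s i x))); first by rewrite ps.
rewrite linear_sum; apply: eq_bigr => i _.
by rewrite [LHS](bP i) -s'P.
Qed.

Lemma homE_separates (x : J) : (forall h : homE r J, h x = 0) -> x = 0.
Proof.
have [n [s [p ps]]] := J_retr => x0.
rewrite -(ps x) big1 // => i _; have [h hP] := ex_homE (s i).
by rewrite -hP x0 linear0.
Qed.

End HomRetract.

(** * Vanishing of Ext from the dominant dimension, in lifting form *)

Section Lifting.
Variables (k : fieldType) (B : falgType k) (M : lmodType B) (E : falgType k).
Variables (r : endR M E) (J : min_inj_resolution E^o) (t : nat).
Hypotheses (fdM : fin_dim M) (M_gen : retr M B^o) (M_cogen : retr M (kdual B)).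
Hypothesis J_proj : forall i, (i < t)%N -> proj_mod (ir_obj J i).

Let J_retr i : (i < t)%N -> retr (emod r) (ir_obj J i).
Proof. by move=> /J_proj J_p; apply: proj_inj_retr_emod (ir_inj J i). Qed.

Let J_fd i : fin_dim (ir_obj J i) := (ir_inj J i).1.

Let M_inj : injx (emod r) := emod_injx fdM M_cogen.

(* [Q] is the start of a projective resolution of [Q 0 = M]. *)
Let Q (p : nat) : lmodType B :=
  if p is q.+1 then homE r (ir_obj J q) else M.

Fact precomp_subproof i (h : homE r (ir_obj J i.+1)) :
  (fun x => h (ir_diff J i x) : M) \in @hom_pred k B M E r (ir_obj J i).
Proof. by apply/asboolP => e x y; rewrite linearP homE_lin. Qed.

Let precomp i (h : homE r (ir_obj J i.+1)) : homE r (ir_obj J i) :=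
  HomE (precomp_subproof h).

Let precomp_lin i : linear (@precomp i).
Proof. by move=> b h h'; apply: homE_ext. Qed.

(** Under Hom_E(E, M) = M, precomposition with the augmentation becomes evaluation at the image of
    1, which is [D 0]. *)
Let D (p : nat) : {linear Q p.+1 -> Q p} :=
  match p with
  | 0 => mklin (@hom_eval_lin k B M E r (ir_obj J 0%N) (ir_aug J 1))
  | i.+1 => mklin (@precomp_lin i)
  end.

(** [M] is injective over [E], so Hom_E(-, M) preserves the exactness of [J]. *)
Let D_exact p x : D p x = 0 <-> exists y, D p.+1 y = x.
Proof.
have augE e : ir_aug J e = e *: ir_aug J 1 by apply: lin_regE.
case: p x => [|i] h; split.
- move=> /= h0.
  have [//|//|x|h' h'P] := M_inj (u := ir_diff J 0%N) (f := hom_lin h).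
    move=> /ir_exact0[e <-]; rewrite augE linearZ.
    by rewrite (h0 : hom_lin h (ir_aug J 1) = 0); apply: scaler0.
  have [g gP] := ex_homE h'; exists g; apply: homE_ext => x.
  by rewrite /= gP h'P.
- move=> [g <-] /=; have -> : ir_diff J 0%N (ir_aug J 1) = 0.
    by apply/ir_exact0; exists 1.
  exact: (linear0 (hom_lin g)).
- move=> /= h0.
  have [//|//|x|h' h'P] := M_inj (u := ir_diff J i.+1) (f := hom_lin h).
    move=> /ir_exact[e <-]; have := congr1 (fun f : homE _ _ => f e) h0.
    by [].
  have [g gP] := ex_homE h'; exists g; apply: homE_ext => x.
  by rewrite /= gP h'P.
- move=> [g <-] /=; apply: homE_ext => x /=.
  have -> : ir_diff J i.+1 (ir_diff J i x) = 0 by apply/ir_exact; exists x.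
  exact: (linear0 (hom_lin g)).
Qed.

Let D0_surj (m : M) : exists h, D 0%N h = m.
Proof.
have [||x|h hP] := M_inj (u := ir_aug J) (f := lact (m : emod r)).
- exact: fin_dim_reg.
- exact: J_fd.
- move=> /eqP; rewrite -(linear0 (ir_aug J)) => /eqP/ir_aug_inj ->.
  by rewrite linear0.
have [g gP] := ex_homE h; exists g.
by rewrite /= gP hP [lact _ _]scale1r.
Qed.

Let Q_retr p : (p < t)%N -> retr B^o (Q p.+1).
Proof. by move=> /J_retr; apply: homE_retr_reg. Qed.

Let Q_fd p : (p <= t)%N -> fin_dim (Q p).
Proof.
by case: p => [//|p] /Q_retr rQ; apply: retr_fin_dim rQ (fin_dim_reg B).
Qed.

(** Embedding [B] in a power of [M] turns [f] into evaluations at elements of [J]. These are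
    cocycles because [f] kills the image of [D p.+2], hence boundaries, and evaluation at preimages
    defines [g]. *)
Let Q_reg_exact p (f : {linear Q p.+2 -> B^o}) : (p.+2 < t)%N ->
  (forall x, f (D p.+2 x) = 0) ->
  exists g : {linear Q p.+1 -> B^o}, forall x, f x = g (D p.+1 x).
Proof.
move=> p_lt fD; have [n [s [pi pis]]] := M_gen.
have /choice[y yP] i : exists y : ir_obj J p,
    forall h : homE r (ir_obj J p.+1), f h *: s i 1 = h (ir_diff J p y).
  have [x xP] :=
    homE_bidual M_gen (J_retr (ltnW p_lt)) (lcomp (lact (s i 1)) f).
  have /ir_exact[y yx] : ir_diff J p.+1 x = 0.
    apply: (homE_separates (J_retr p_lt)) => h.
    by have := xP (D p.+2 h); rewrite /= [f _]fD scale0r => <-.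
  by exists y => h; rewrite yx -xP.
exists (mklin (sum_lin (fun i =>
  lcomp (pi i) (mklin (@hom_eval_lin k B M E r _ (y i)))))).
move=> h /=; rewrite -[LHS]pis; apply: eq_bigr => i _.
by rewrite -yP lin_regE.
Qed.

Variable I : min_inj_resolution B^o.
Hypothesis I_inj : forall i, injx (ir_obj I i).

(** The resolution with [B] prepended, so that indices are shifted by one against [I]. *)
Let Y (q : nat) : lmodType B := if q is i.+1 then ir_obj I i else B^o.

Let d (q : nat) : {linear Y q -> Y q.+1} :=
  match q with 0 => ir_aug I | i.+1 => ir_diff I i end.

Let d_exact q x : d q.+1 x = 0 <-> exists y, d q y = x.
Proof. by case: q x => [|q] x; [apply: ir_exact0 | apply: ir_exact]. Qed.

(* Diagram chase in the double complex Hom(Q, Y), whose rows are exact where Y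
   is injective and whose columns are exact where Q is projective. *)
Let chase q p (f : {linear Q p.+1 -> Y q.+1}) :
  (0 < p + q)%N -> (p + q.+1 < t)%N ->
  (forall x, exists y, d q y = f x) -> (forall x, f (D p.+1 x) = 0) ->
  exists g : {linear Q p -> Y q}, forall x, f x = d q (g (D p x)).
Proof.
elim: q p f => [|q IH] p f pq_gt0 pq_lt f_im fD.
  (* With [q = 0] the hypothesis [0 < p + q] makes [p] positive, the range covered by
     [Q_reg_exact]. *)
  case: p f pq_gt0 pq_lt f_im fD => [//|p] f _ pq_lt f_im fD.
  rewrite addn1 in pq_lt.
  have [g gP] := retr_proj_lift (Q_retr (ltnW pq_lt)) f_im.
  have [x|h hP] := @Q_reg_exact p g pq_lt.
    by apply: (@ir_aug_inj _ _ _ I); rewrite [LHS]gP fD linear0.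
  by exists h => x; rewrite -gP hP.
have p_lt : (p < t)%N by apply: leq_trans pq_lt; rewrite ltnS leq_addr.
have [g gP] := retr_proj_lift (Q_retr p_lt) f_im.
have [||x|x|h hP] := IH p.+1 (lcomp g (D p.+1)).
- by rewrite addSn.
- by rewrite addSnnS.
- by apply/d_exact; rewrite /= gP fD.
- have DD : D p.+1 (D p.+2 x) = 0 by apply/D_exact; exists x.
  exact: etrans (congr1 g DD) (linear0 g).
(* Subtracting [d q (h x)] from the lift [g] of [f] gives another lift, which now kills the kernel
   of [D p] and so extends along [D p]. *)
have gh_lin : linear (fun x => g x - d q (h x)).
  move=> b x y; rewrite (linearP g) (linearP h) (linearP (d q)).
  rewrite scalerBr opprD -!addrA.
  by congr (_ + _); rewrite addrCA.
have [||x|w wP] := I_inj (u := D p) (f := mklin gh_lin).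
- exact: Q_fd.
- by apply: Q_fd; apply: ltnW.
- by move=> /D_exact[y <-] /=; have := hP y => /= ->; rewrite subrr.
exists w => x; rewrite wP /= linearB -gP.
by rewrite (_ : d q.+1 (d q _) = 0) ?subr0 //; apply/d_exact; exists (h x).
Qed.

(** This is Ext^(i+1)(DB, B) = 0. As DB is a summand of a power of [M], it follows from [chase] at
    [p = 0], where surjectivity of [D 0] allows cancelling it. *)
Lemma kdual_lift i (f : {linear kdual B -> ir_obj I i.+1}) : (i.+2 < t)%N ->
  (forall x, exists y, ir_diff I i y = f x) ->
  exists g : {linear kdual B -> ir_obj I i}, forall x, f x = ir_diff I i (g x).
Proof.
move=> i_lt f_im; have [n [s [p ps]]] := M_cogen.
have /choice[g gP] j : exists g : {linear M -> ir_obj I i},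
    forall m, f (p j m) = ir_diff I i (g m).
  have [||x|x|g gP] := @chase i.+1 0%N (lcomp (lcomp f (p j)) (D 0%N)).
  - by [].
  - by [].
  - exact: f_im.
  - have DD : D 0%N (D 1%N x) = 0 by apply/D_exact; exists x.
    by have := congr1 (lcomp f (p j)) DD; rewrite linear0.
  by exists g => m; have [h <-] := D0_surj m; apply: gP.
exists (mklin (sum_lin (fun j => lcomp (g j) (s j)))) => x /=.
by rewrite -[in LHS](ps x) !linear_sum; apply: eq_bigr => j _; rewrite gP.
Qed.

End Lifting.

(** * Generators over symmetric algebras *)

Section SymmetricForm.
Variables (k : fieldType) (L : falgType k).

(** The symmetrizing form of [L]; [sf_rep] identifies Hom_k(N, k) with Hom_L(N, L). *)
Record symm_form := SymmForm {
  sf_form : L -> k;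
  sf_lin : @kfun k L L^o sf_form;
  sf_sym : forall x y, sf_form (x * y) = sf_form (y * x);
  sf_nondeg : forall x, (forall y, sf_form (y * x) = 0) -> x = 0;
  sf_rep : forall (N : lmodType L) (l : N -> k), kfun l ->
    exists p : {linear N -> L^o}, forall n, sf_form (p n) = l n
}.

(** The form is the image of 1 under the bimodule isomorphism from [L] to DL; compatibility with the
    right actions makes it symmetric. *)
Lemma ex_symm_form : symmetric_algebra L ->
  (exists th : symm_form, True) /\ retr L^o (kdual L).
Proof.
move=> [f [[f' fK f'K] f_bimod]].
have f'_lin : linear f'.
  by move=> a x y; apply: (can_inj fK); rewrite linearP !f'K.
split; last first.
  exists 1%N, (fun=> mklin f'_lin), (fun=> f) => g.
  by rewrite big_ord1 /= f'K.
pose th x := kdual_fun (f 1) x.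
have thE x y : kdual_fun (f x) y = th (y * x).
  by rewrite (lin_regE f) kdual_scaleE.
have th_lin : @kfun k L L^o th by apply: kdual_fun_lin.
have th_sym x y : th (x * y) = th (y * x).
  by rewrite -thE -[y in LHS]mul1r f_bimod.
have th_nondeg x : (forall y, th (y * x) = 0) -> x = 0.
  move=> x0; apply: (can_inj fK); rewrite linear0; apply: kdual_funP => y.
  by rewrite thE x0 kdual_fun0.
suff th_rep (N : lmodType L) (l : N -> k) : kfun l ->
    exists p : {linear N -> L^o}, forall n, th (p n) = l n.
  by exists (SymmForm th_lin th_sym th_nondeg th_rep).
move=> l_lin; have [h hP] := ex_dual_map l_lin.
exists (lcomp (mklin f'_lin) h) => n.
by rewrite -[_ n]mul1r -thE /= f'K hP scale1r.
Qed.

End SymmetricForm.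

(** * The natural isomorphisms N = Hom_A(DA, N) and A = Hom_A(DA, A) *)

Section Nakayama.
Variables (k : fieldType) (L : falgType k) (th : symm_form L).
Variables (N : lmodType L) (A : falgType k) (r : endR N A).
Hypotheses (fdN : fin_dim N) (N_gen : retr N L^o).
Variable F : frame N.
Variable pi : (N -> k) -> {linear N -> L^o}.
Hypothesis piP : forall l, kfun l -> forall n, sf_form th (pi l n) = l n.
(* [brk y l] is the image of [y (x) pi l] under the map from
   [N (x) Hom_L(N, L)] to [A = End_L(N)]. *)
Variable brk : N -> (N -> k) -> A.
Hypothesis brkP : forall y l (n : emod r), brk y l *: n = pi l n *: y.
Variable hat : (N -> k) -> {linear emod r -> kdual A}.
Hypothesis hatP : forall l, kfun l ->
  forall n (a : A), kdual_fun (hat l n) a = l (a *: n).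

Let c_lin := @fr_lin _ _ _ F.

Let mul_lin (p : {linear N -> L^o}) (y : L) n : y * p n = p (y *: n).
Proof. by rewrite linearZ. Qed.

Let pi_uniq (l : N -> k) (p : {linear N -> L^o}) : kfun l ->
  (forall n, sf_form th (p n) = l n) -> pi l =1 p.
Proof.
move=> l_lin pP n; apply/eqP; rewrite -subr_eq0; apply/eqP.
apply: (sf_nondeg (s := th)) => y.
by rewrite mulrBr (kfunB (sf_lin th)) !mul_lin piP // pP subrr.
Qed.

Let c_inj (x y : N) : (forall l, kfun l -> l x = l y) -> x = y.
Proof.
move=> xy; rewrite (fr_sum F x) (fr_sum F y).
by apply: eq_bigr => j _; rewrite xy.
Qed.

Let kfun_act (a : A) (l : N -> k) : kfun l ->
  @kfun k L N (fun n => l (a *: (n : emod r))).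
Proof. by move=> l_lin c x y; rewrite !emodE linearP l_lin. Qed.

Let brk_mulr y l (a : A) : kfun l ->
  brk y l * a = brk y (fun n : emod r => l (a *: n)).
Proof.
move=> l_lin; apply: (@emod_ext _ _ _ _ r) => n.
rewrite -scalerA !brkP.
rewrite (pi_uniq (p := lcomp (pi l) (er_act r a)) (kfun_act a l_lin)) // => m.
by rewrite /= piP.
Qed.

(** Balancedness over [L]. Symmetry of the form enters here: it shows that the functional
    [l (b *: _)] is represented by [pi l] followed by right multiplication by [b]. *)
Let brk_scale y l (b : L) : kfun l ->
  brk (b *: y) l = brk y (fun n => l (b *: n)).
Proof.
move=> l_lin; apply: (@emod_ext _ _ _ _ r) => n; rewrite !brkP scalerA.
have p_lin : @linear_for L N L^o *:%R (fun n => pi l n * b).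
  move=> a x z; rewrite linearP mulrDl; congr (_ + _).
  exact/esym/mulrA.
have lb_lin : kfun (fun n => l (b *: n)).
  by move=> c x z; rewrite scalerDr -alg_scaleA l_lin.
rewrite (pi_uniq (p := mklin p_lin) lb_lin) // => m /=.
rewrite sf_sym; have := piP l_lin (b *: m).
by rewrite linearZ.
Qed.

Let brkD y z l : brk (y + z) l = brk y l + brk z l.
Proof.
by apply: (@emod_ext _ _ _ _ r) => n; rewrite scalerDl !brkP scalerDr.
Qed.

Let brk_sum y l : kfun l ->
  brk y l = \sum_j l (fr_vec j) *: brk y (fr_coord (f := F) j).
Proof.
move=> l_lin; apply: (@emod_ext _ _ _ _ r) => n.
have p_lin : linear (fun n =>
    \sum_j (l (fr_vec j))%:A *: pi (fr_coord (f := F) j) n).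
  move=> a x z; rewrite scaler_sumr -big_split; apply: eq_bigr => j _.
  by rewrite linearP scalerDr alg_scaleA.
rewrite brkP (pi_uniq (p := mklin p_lin) l_lin) /=; last first.
  move=> m; rewrite (kfun_sum (sf_lin th)).
  rewrite [in RHS](fr_sum F m) (kfun_sum l_lin).
  apply: eq_bigr => j _; rewrite (kfunZ (sf_lin th)) (kfunZ l_lin) piP //.
  by rewrite mulrC.
rewrite !scaler_suml; apply: eq_bigr => j _.
by rewrite -scalerA -[in RHS]mulr_algl -scalerA brkP emod_alg.
Qed.

(* The isomorphism from [N] to [Hom_A(DA, N)]. *)
Definition nak (x : N) (g : kdual A) : emod r :=
  \sum_j (kdual_fun g (brk x (fr_coord (f := F) j)))%:A *: (fr_vec j : N).

(** Determines [nak x g] independently of the frame; the algebraic properties of [nak] follow from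
    those of [brk]. *)
Lemma nakP x g (l : N -> k) : kfun l -> l (nak x g) = kdual_fun g (brk x l).
Proof.
move=> l_lin; rewrite (brk_sum _ l_lin) (kfun_sum (kdual_fun_lin g)).
rewrite (kfun_sum l_lin); apply: eq_bigr => j _.
rewrite (kfunZ l_lin) mulrC -mulr_algl.
by apply/esym/(kfunZ (kdual_fun_lin g)).
Qed.

Lemma nak_lin x : linear (nak x).
Proof.
move=> a g g'; apply: c_inj => l l_lin.
rewrite nakP // kdual_funD kdual_scaleE (kfunD l_lin) nakP // brk_mulr //.
by rewrite (nakP x g (kfun_act a l_lin)).
Qed.

Lemma nakD x y g : nak (x + y) g = nak x g + nak y g.
Proof.
apply: c_inj => l l_lin.
by rewrite (kfunD l_lin) !nakP // brkD (kfunD (kdual_fun_lin g)).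
Qed.

Lemma nak_scale (b : L) x g : nak (b *: x) g = b *: (nak x g : N).
Proof.
apply: c_inj => l l_lin; rewrite nakP // brk_scale // -(nakP x g) //.
by move=> c y z; rewrite scalerDr -alg_scaleA l_lin.
Qed.

Lemma nak0 g : nak 0 g = 0.
Proof. by apply: (addIr (nak 0 g)); rewrite -nakD !add0r. Qed.

Lemma nak_sum n (x : 'I_n -> N) g : nak (\sum_i x i) g = \sum_i nak (x i) g.
Proof. exact: (big_morph (nak^~ g) (fun x y => nakD x y g) (nak0 g)). Qed.

(** An [A]-endomorphism of [N] is multiplication by an element of [L], and [nak] is [L]-linear in
    [x]. *)
Lemma nak_natural (f : {linear emod r -> emod r}) x g :
  f (nak x g) = nak (f x) g.
Proof. by have [b bP] := emod_end N_gen f; rewrite !bP nak_scale. Qed.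

Lemma kdual_separates (a : A) :
  (forall g : kdual A, kdual_fun g a = 0) -> a = 0.
Proof.
have [G _] := ex_frame (fin_dim_reg A).
move=> a0; apply: (@crow_inj _ _ _ G); apply/rowP => i; rewrite !mxE.
by have [g <-] := ex_kdual (@fr_lin _ _ _ G i).
Qed.

(** Shows that [N] equals its product with the ideal spanned by the [brk y l]: since [N] is a
    generator, 1 is a sum of elements [p i (s i 1)]. *)
Lemma ex_brk_dec : exists n (u : 'I_n -> emod r) (l : 'I_n -> N -> k),
  (forall i, kfun (l i)) /\ forall x : emod r, x = \sum_i brk x (l i) *: u i.
Proof.
have [n [s [p ps]]] := N_gen.
have l_lin i : kfun (fun x => sf_form th (p i x)).
  exact: kfun_comp (linear_kmap (p i)) (sf_lin th).
exists n, (fun i => s i 1), (fun i x => sf_form th (p i x)); split=> // x.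
transitivity ((\sum_i p i (s i 1)) *: (x : N)); first by rewrite ps scale1r.
rewrite scaler_suml; apply: eq_bigr => i _.
by rewrite brkP (pi_uniq (l_lin i) (fun=> erefl)).
Qed.

Lemma nak_inj x y : (forall g, nak x g = nak y g) -> x = y.
Proof.
move=> xy; have [n [u [l [l_lin lP]]]] := ex_brk_dec.
rewrite [LHS](lP x) [RHS](lP y); apply: eq_bigr => i _.
suff -> : brk x (l i) = brk y (l i) by [].
apply/eqP; rewrite -subr_eq0; apply/eqP; apply: kdual_separates => g.
by rewrite (kfunB (kdual_fun_lin g)) -!nakP // xy subrr.
Qed.

(** Evaluation at the frame embeds [A] in a power of [N]; a [k]-linear retraction splits [g] into
    functionals on the factors. *)
Lemma kdual_span (g : kdual A) : exists l : 'I_(fr_dim F) -> N -> k,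
  (forall j, kfun (l j)) /\ g = \sum_j hat (l j) (fr_vec j).
Proof.
have u_lin : linear (fun a : A^o =>
    [ffun j => a *: (fr_vec (f := F) j : emod r)]).
  by move=> a x y; apply/ffunP => j; rewrite !ffunE scalerDl scalerA.
have [|s [s_lin sP]] :=
    ex_pseudo_inverse (u := mklin u_lin) (fin_dim_reg A) _ (linear_kmap _).
  exact: fin_dim_ffun (emod_fin_dim r fdN).
have u_inj (a b : A) : mklin u_lin a = mklin u_lin b -> a = b.
  move=> /ffunP ab; apply: (@emod_ext _ _ _ _ r) => m.
  rewrite (fr_sum F m) !emodE !linear_sum; apply: eq_bigr => j _.
  by rewrite !linearZ; have := ab j; rewrite /= !ffunE !emodE => ->.
pose l j (n : N) :=
  kdual_fun g (s [ffun i => if i == j then n : emod r else 0]).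
have l_lin j : kfun (l j).
  apply/(emod_kfun r) => c x y; rewrite /l.
  rewrite (_ : [ffun i => _] =
      c%:A *: [ffun i => if i == j then x : emod r else 0]
      + [ffun i => if i == j then y : emod r else 0]).
    by rewrite s_lin (kdual_fun_lin g).
  by apply/ffunP => i; rewrite !ffunE; case: eqP; rewrite ?scaler0 ?addr0.
exists l; split=> //; apply: kdual_funP => a.
have gs_lin : kfun (fun w => kdual_fun g (s w)).
  exact: kfun_comp s_lin (kdual_fun_lin g).
rewrite (kfun_sum (kdual_ev_lin a)) -{1}(u_inj _ _ (sP a)).
under eq_bigr do rewrite hatP //.
rewrite /l -(kfun_sum gs_lin); congr (kdual_fun g (s _)).
apply/ffunP => i; rewrite sum_ffunE (bigD1 i) //= !ffunE eqxx big1 ?addr0 //.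
by move=> j /negPf ji; rewrite ffunE eq_sym ji.
Qed.

(** Each [f] after [hat l] is multiplication by some [b l] in [L]. The form applied to [b l] is
    linear in [l], so it is evaluation at a point [x] of [N], and the values of the [hat l] span
    DA. *)
Lemma nak_surj (f : {linear kdual A -> emod r}) :
  exists x, forall g, f g = nak x g.
Proof.
have /choice[b bP] l := emod_end N_gen (lcomp f (hat l)).
have b_uniq (x y : L) : (forall n : N, x *: n = y *: n) -> x = y.
  move=> xy; apply/eqP; rewrite -subr_eq0; apply/eqP.
  by apply: (emod_faithful N_gen) => n; rewrite scalerBl xy subrr.
have b_sum l : kfun l ->
    b l = \sum_j (l (fr_vec j))%:A * b (fr_coord (f := F) j).
  move=> l_lin; apply: b_uniq => n; rewrite -bP scaler_suml.
  have -> : lcomp f (hat l) n =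
      f (\sum_j (l (fr_vec j))%:A *: hat (fr_coord (f := F) j) n).
    congr (f _).
    apply: kdual_funP => a; rewrite hatP // (kfun_sum (kdual_ev_lin a)).
    rewrite {1}(fr_sum F (a *: (n : emod r))) (kfun_sum l_lin).
    apply: eq_bigr => j _.
    by rewrite (kfunZ (kdual_ev_lin a)) (kfunZ l_lin) hatP // mulrC.
  rewrite linear_sum; apply: eq_bigr => j _.
  by rewrite linearZ [LHS]emod_alg -scalerA -bP.
pose x : N := \sum_j (sf_form th (b (fr_coord (f := F) j)))%:A *: fr_vec j.
have xP l : kfun l -> l x = sf_form th (b l).
  move=> l_lin; rewrite (b_sum l) // (kfun_sum l_lin) (kfun_sum (sf_lin th)).
  apply: eq_bigr => j _; rewrite (kfunZ l_lin) mulrC.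
  exact/esym/(kfunZ (sf_lin th)).
exists x => g; have [l [l_lin ->]] := kdual_span g.
rewrite linear_sum.
rewrite -[RHS]/(mklin (nak_lin x) _) linear_sum; apply: eq_bigr => j _.
rewrite [mklin _ _]/=; apply: c_inj => m m_lin.
rewrite nakP // hatP // brkP [f _](bP (l j)).
set c := pi m _; have lc_lin : kfun (fun n => l j (c *: n)).
  by move=> e y z; rewrite scalerDr -alg_scaleA (l_lin j).
have bc : b (fun n => l j (c *: n)) = b (l j) * c.
  apply: b_uniq => n; rewrite -bP -scalerA -[RHS]bP /=; congr (f _).
  by apply: kdual_funP => a; rewrite !hatP // -emod_comm.
by rewrite (xP _ lc_lin) bc /c mul_lin piP.
Qed.

(** A map from DA to [I] corresponds to an element [y] of [I]; the correspondence is expressed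
    through test maps into [N]. *)
Lemma nak_rep_retr (I : lmodType A) (h : {linear kdual A -> I}) :
  retr (emod r) I ->
  exists y, forall (f : {linear I -> emod r}) g, f (h g) = nak (f y) g.
Proof.
move=> [n [s [p ps]]].
have /choice[x xP] i := nak_surj (lcomp (s i) h).
exists (\sum_i p i (x i)) => f g.
rewrite -[in LHS](ps (h g)) !linear_sum nak_sum; apply: eq_bigr => i _.
rewrite [s i (h g)](xP i g).
exact: (nak_natural (lcomp f (p i))).
Qed.

(** Following [h] by evaluation at [n] gives an element [y n] of [N] that depends [L]-linearly on
    [n], hence an element of [A]. *)
Lemma nak_rep_reg (h : {linear kdual A -> A^o}) :
  exists y, forall (f : {linear A^o -> emod r}) g, f (h g) = nak (f y) g.
Proof.
have /choice[y yP] n := nak_surj (lcomp (lact (n : emod r)) h).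
have y_lin : @linear_for L N N *:%R y.
  move=> b m n; apply: nak_inj => g.
  rewrite nakD nak_scale -!yP /=.
  by rewrite scalerDr emod_comm.
have [a aP] := ex_emod r (mklin y_lin); exists a => f g.
by rewrite (lin_regE f (h g)) (lin_regE f a) aP -yP.
Qed.

(* The elements of [I] whose class modulo the image of [d] is killed by all maps
   to [N] are those sent into the image of [d] by the ideal spanned by the
   [brk y l].  As DA equals its product with this ideal, such an element [x]
   defines a map from DA to [I] that lands in the image of [d]. *)
Lemma ex_cogenerating (I' I : lmodType A) (d : {linear I' -> I}) :
  fin_dim I' -> fin_dim I -> retr (emod r) I ->
  (forall f : {linear kdual A -> I}, (forall g, exists y, d y = f g) ->
    exists h : {linear kdual A -> I'}, forall g, f g = d (h g)) ->
  (forall h : {linear kdual A -> I'}, exists y,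
    forall (f : {linear I' -> emod r}) g, f (h g) = nak (f y) g) ->
  exists (T : finType) (G : T -> {linear I -> emod r}),
    (forall i y, G i (d y) = 0) /\
    (forall x, (forall i, G i x = 0) -> exists y, d y = x).
Proof.
move=> fdI' fdI I_retr d_lift I'_rep.
have [m [mu [mu_d mu_im]]] := ex_image_equations d fdI' fdI.
pose G (ij : 'I_m * 'I_(fr_dim F)) : {linear I -> emod r} :=
  lcomp (mklin (nak_lin (fr_vec ij.2))) (mu ij.1).
exists ('I_m * 'I_(fr_dim F))%type, G; split=> [ij y|].
  by rewrite /= mu_d; exact: (linear0 (mklin (nak_lin _))).
(* By [nakP], vanishing of [G] at [x] says that every [mu i x] kills all [brk y l], which are the
   equations for [brk y l *: x] to lie in the image of [d]. *)
have brk_im x : (forall ij, G ij x = 0) -> forall y l, kfun l ->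
    exists z, d z = brk y l *: x.
  move=> Gx y l l_lin; apply: mu_im => i; rewrite linearZ kdual_scaleE mul1r.
  rewrite -nakP // (fr_sum F y) nak_sum big1 ?(kfun0 l_lin) // => j _.
  by rewrite nak_scale; have /= -> := Gx (i, j); rewrite scaler0.
have [n [u [l [l_lin lP]]]] := ex_brk_dec.
have [q [s [p ps]]] := I_retr => x Gx.
pose f := mklin (sum_lin (fun j => lcomp (p j) (mklin (nak_lin (s j x))))).
have f_nat (e : {linear I -> emod r}) g : e (f g) = nak (e x) g.
  rewrite -[in RHS](ps x) /= !linear_sum nak_sum; apply: eq_bigr => j _.
  exact: (nak_natural (lcomp e (p j))).
have Gf g ij : G ij (f g) = 0 by rewrite f_nat Gx nak0.
have d_sum k' (z : 'I_k' -> I) : (forall i, exists y, d y = z i) ->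
    exists y, d y = \sum_i z i.
  move=> /choice[y yP]; exists (\sum_i y i); rewrite linear_sum.
  exact: eq_bigr.
have f_im g : exists y, d y = f g.
  have [l' [_ ->]] := kdual_span g; rewrite linear_sum; apply: (d_sum) => j.
  rewrite [fr_vec j]lP !linear_sum; apply: (d_sum) => i.
  rewrite !linearZ; apply: brk_im => //; exact: Gf.
have [h hP] := d_lift f f_im; have [y yP] := I'_rep h.
(* By naturality [x] and [d y] represent the same map from DA, so [nak_inj] identifies them
   coordinatewise. *)
exists y; rewrite -(ps x) -(ps (d y)); apply: eq_bigr => j _; congr (p j _).
apply: nak_inj => g; rewrite -[RHS]f_nat hP.
exact: esym (yP (lcomp (s j) d) g).
Qed.

End Nakayama.

(** * Climbing the injective resolution *)

Section EssentialRetract.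
Variables (k : fieldType) (A : falgType k).

(** The [G i] extend along [u] to [U]. The common kernel of the extensions meets [W] only in 0, so
    it vanishes by essentiality. *)
Lemma essential_retr (M Y U : lmodType A) (u : {linear Y -> U}) (W : set U)
    (T : finType) (G : T -> {linear Y -> M}) :
  fin_dim M -> injx M -> fin_dim Y -> inj_mod U -> essential W ->
  (forall z, W z -> exists y, u y = z) ->
  (forall i y, u y = 0 -> G i y = 0) ->
  (forall y, (forall i, G i y = 0) -> u y = 0) -> retr M U.
Proof.
move=> fdM M_inj fdY U_inj [_ W_ess] WP uG Gu.
have /choice[g gP] i : exists g : {linear U -> M}, forall y, g (u y) = G i y.
  exact: M_inj fdY U_inj.1 (uG i).
apply: (retr_cogenerated (f := g)) => // x gx; apply: contrapT => x0.
have [||z [gz /WP[y uy]]] := W_ess (fun z => forall i, g i z = 0).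
- split=> [i /=|a y z gy gz i /=]; first exact: linear0.
  by rewrite linearP (gy i) (gz i) scaler0 addr0.
- by exists x.
by apply; rewrite -uy; apply: Gu => i; rewrite -gP uy gz.
Qed.

End EssentialRetract.

Section GendoSymmetric.
Variables (k : fieldType) (L : falgType k) (th : symm_form L).
Variables (N : lmodType L) (A : falgType k) (r : endR N A).
Hypotheses (fdN : fin_dim N) (N_gen : retr N L^o) (N_cogen : retr N (kdual L)).
Variable I : min_inj_resolution A^o.
Variable t : nat.
Hypothesis kdual_lifts : forall i (f : {linear kdual A -> ir_obj I i.+1}),
  (i.+2 < t)%N -> (forall x, exists y, ir_diff I i y = f x) ->
  exists g : {linear kdual A -> ir_obj I i}, forall x, f x = ir_diff I i (g x).

Lemma inj_resolution_retr i : (i < t)%N -> retr (emod r) (ir_obj I i).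
Proof.
have [F _] := ex_frame fdN.
have /choice[pi piP] (l : N -> k) : exists p : {linear N -> L^o},
    kfun l -> forall n, sf_form th (p n) = l n.
  (* Functions that are not linear get the zero map, so that [choice] applies to all [l]. *)
  case: (pselect (kfun l)) => [/(sf_rep th)[p pP]|nl]; first by exists p.
  have zero_lin : linear (fun _ : N => 0 : L^o).
    by move=> a x y; rewrite scaler0 addr0.
  by exists (mklin zero_lin).
have /choice[brk brkP] (yl : N * (N -> k)) : exists b : A,
    forall n : emod r, b *: n = pi yl.2 n *: yl.1.
  have [b bP] := ex_emod r (lcomp (lact yl.1) (pi yl.2)).
  by exists b => n; rewrite bP.
have /choice[hat hatP] (l : N -> k) : exists h : {linear emod r -> kdual A},
    kfun l -> forall n (a : A), kdual_fun (h n) a = l (a *: n).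
  case: (pselect (kfun l)) => [/(emod_kfun r)/ex_dual_map[h hP]|nl].
    by exists h.
  have zero_lin : linear (fun _ : emod r => 0 : kdual A).
    by move=> a x y; rewrite scaler0 addr0.
  by exists (mklin zero_lin).
pose brkP' y l := brkP (y, l).
have cogen := ex_cogenerating (F := F) fdN N_gen piP brkP' hatP.
have rep_retr := nak_rep_retr fdN N_gen F piP brkP' hatP.
have rep_reg := nak_rep_reg fdN N_gen F piP brkP' hatP.
have fdI j : fin_dim (ir_obj I j) := (ir_inj I j).1.
have fdNA := emod_fin_dim r fdN.
have N_inj : injx (emod r) := emod_injx fdN N_cogen.
have ess_retr := essential_retr fdNA N_inj.
elim/ltn_ind: i => -[|[|i]] IH i_lt.
- apply: (ess_retr _ _ (ir_aug I) _ _
    (fun j => lact (fr_vec (f := F) j : emod r))).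
  + exact: fin_dim_reg.
  + exact: ir_inj.
  + exact: (ir_min I 0%N).
  + by move=> z /ir_exact0.
  + move=> j y; rewrite -(linear0 (ir_aug I)) => /ir_aug_inj ->.
    by rewrite linear0.
  + move=> y y0; suff -> : y = 0 by rewrite linear0.
    apply: (@emod_ext _ _ _ _ r) => m; rewrite scale0r.
    rewrite (fr_sum F m) emodE linear_sum big1 // => j _.
    by rewrite linearZ; have := y0 j; rewrite /= emodE => ->; rewrite scaler0.
(* For the second term no Ext vanishing is used: lifts along the augmentation exist and are linear
   because it is injective. *)
- have [|||f f_im|h|T [G [Gd Gx]]] := cogen _ _ (ir_aug I).
  + exact: fin_dim_reg.
  + exact: fdI.
  + by apply: IH => //; apply: ltnW.
  + have /choice[h hP] := f_im.
    have h_lin : linear (h : kdual A -> A^o).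
      move=> a x y; apply: (@ir_aug_inj _ _ _ I).
      by rewrite linearP !hP linearP.
    by exists (mklin h_lin).
  + exact: rep_reg.
  apply: (ess_retr _ _ (ir_diff I 0%N) _ _ G).
  + exact: fdI.
  + exact: ir_inj.
  + exact: (ir_min I 1%N).
  + by move=> z /ir_exact.
  + by move=> j y /ir_exact0[x <-].
  + by move=> y /Gx/ir_exact0.
- have [|||f f_im|h|T [G [Gd Gx]]] := cogen _ _ (ir_diff I i).
  + exact: fdI.
  + exact: fdI.
  + by apply: IH => //; apply: ltnW.
  + exact: kdual_lifts.
  + apply: rep_retr.
    by apply: IH; rewrite // (ltnW (ltnW i_lt)).
  apply: (ess_retr _ _ (ir_diff I i.+1) _ _ G).
  + exact: fdI.
  + exact: ir_inj.
  + exact: (ir_min I i.+2).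
  + by move=> z /ir_exact.
  + by move=> j y /ir_exact[x <-].
  + by move=> y /Gx/ir_exact.
Qed.

End GendoSymmetric.

Theorem corollary3p3 (k : fieldType) (A : falgType k) :
  gendo_symmetric A -> enat_le (rigdim A) (domdim A).
Proof.
move=> [L [N [L_symm fdN /in_add_retr N_gen /is_EndP[r _]]]].
have [[th _] L_retr] := ex_symm_form L_symm.
(* Over a symmetric algebra DL is isomorphic to [L], so a generator is a cogenerator. *)
have N_cogen : retr N (kdual L) := retr_trans N_gen L_retr.
have [_ rigdim_lub] := esupP [set d | exists (M : lmodType A) (E : falgType k),
  [/\ fin_dim M, generator_cogenerator M, is_End M E,
      gldim E <> einfty & d = domdim E]].
apply: rigdim_lub => x [M [E [fdM [/in_add_retr M_gen /in_add_retr M_cogen]]]].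
move=> /is_EndP[rM _] _ ->.
have [_ domdim_lub] := esupP [set d |
  exists (t : nat) (J : min_inj_resolution E^o),
    d = Some t /\ forall i, (i < t)%N -> proj_mod (ir_obj J i)].
apply: domdim_lub => y [t [J [-> J_proj]]].
have [domdim_ub _] := esupP [set d |
  exists (t : nat) (J : min_inj_resolution A^o),
    d = Some t /\ forall i, (i < t)%N -> proj_mod (ir_obj J i)].
have [I I_inj] := ex_min_inj_resolution (fin_dim_reg A).
apply: domdim_ub; exists t, I; split=> // i i_lt.
apply/proj_modP; split; first by case: (ir_inj I i).
(* [N] is projective over [A], so it suffices to place the first [t] terms in add(N). *)
apply: retr_trans (emod_retr_reg r N_gen) _.
apply: (inj_resolution_retr th r fdN N_gen N_cogen _ i_lt) => j f.
exact: (kdual_lift rM fdM M_gen M_cogen J_proj I_inj).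
Qed.
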